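(* There exist absolute constants $\delta_0\in(0,1)$ and $C>0$ such that the following holds for every $0<\delta\le\delta_0$. Let $m=m(N)=\lfloor\delta N^{1/2}\rfloor+1$ for $N\in\mathbb{N}$. Let $\{p_j\}_{j=1}^m\subset\mathbb{S}$, $m\in\mathbb{N}$, be a family of point configurations (one for each $m$; the dependence of $p_j$ on $m$ is suppressed) satisfying the following two conditions. (S) There is a constant $c>0$, independent of $m$, such that $\operatorname{dist}(p_j,p_k)\ge\frac{c}{\sqrt m}$ for all $j\ne k$. (G) There is a function $L(m)\ge1$ such that $\#\{j:p_j\in\mathcal{N}_{m^{-1}}(G)\}\le L(m)$ for all great circles $G\subset\mathbb{S}$. For each $N$, let $Q_j$ be a Gaussian beam of degree $N$ with pole $p_j$ ($1\le j\le m=m(N)$), and set $$F_N=\sum_{j=1}^mQ_j,\qquad u_N=\frac{F_N}{\|F_N\|_{L^2(\mathbb{S})}}.$$ Then for all sufficiently large $N$, $F_N\ne0$ and $$\|u_N\|_{L^\infty(\mathbb{S})}\le C\delta^{-\frac12}L(m).$$ In particular, if (G) holds with $L(m)=O(1)$ as $m\to\infty$, then the $u_N$ are uniformly bounded as $N\to\infty$.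
   Context: $\mathbb{S}\subset\mathbb{R}^3$ is the two-dimensional unit sphere with the round metric, $\operatorname{dist}$ is geodesic distance, and $\mathcal{N}_r(\Omega)=\{x\in\mathbb{S}:\operatorname{dist}(\Omega,x)\le r\}$ for $\Omega\subset\mathbb{S}$. $\mathbb{SH}_N$ is the space of (complex-valued) spherical harmonics of degree $N$, i.e. restrictions to $\mathbb{S}$ of homogeneous harmonic polynomials of degree $N$ on $\mathbb{R}^3$. Gaussian beams: let $Q_0(x)=C_NN^{1/4}(x_1+ix_2)^N$, with $C_N>0$ chosen so that $\|Q_0\|_{L^2(\mathbb{S})}=1$; its pole is the north pole $p_0=(0,0,1)$. For $p\in\mathbb{S}$, a Gaussian beam of degree $N$ with pole $p$ is a function $Q_0\circ R^{-1}\in\mathbb{SH}_N$ with $R\in\mathrm{SO}(3)$, $Rp_0=p$; it is determined by $p$ up to a constant factor of modulus one, and any choice is allowed. *)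

(* Defs.v *)
From HB Require Import structures.
From mathcomp Require Import all_boot all_order all_algebra.
From mathcomp Require Import all_classical all_reals all_analysis.
From mathcomp Require Import measurable_realfun.
From mathcomp Require Import complex.

Set Implicit Arguments.
Unset Strict Implicit.
Unset Printing Implicit Defensive.

Import Order.TTheory GRing.Theory Num.Theory.
Import numFieldNormedType.Exports.

Local Open Scope classical_set_scope.
Local Open Scope ring_scope.

Section Sphere.
Variable R : realType.

Definition dot (x y : 'cV[R]_3) : R := \sum_(i < 3) x i 0 * y i 0.

Definition sphere : Type := {x : 'cV[R]_3 | dot x x == 1}.

Definition north_pole_vec : 'cV[R]_3 := delta_mx 2%:R 0.

Lemma north_pole_subproof : dot north_pole_vec north_pole_vec == 1.
Proof.
by apply/eqP; rewrite /dot !big_ord_recr big_ord0 /= !mxE /=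
  ?(mulr0, mul0r, add0r, mul1r).
Qed.

Definition north_pole : sphere := exist _ north_pole_vec north_pole_subproof.

HB.instance Definition _ := SubChoice.on sphere.
HB.instance Definition _ := isPointed.Build sphere north_pole.

Definition sphere_coord (i : 'I_3) (x : sphere) : measurableTypeR R :=
  val x i 0.

Definition sphere_borel : set (set sphere) := g_sigma_preimage sphere_coord.

Let sphere_set0 : sphere_borel set0.
Proof. exact: sigma_algebra0. Qed.

Let sphere_setC A : sphere_borel A -> sphere_borel (~` A).
Proof. exact: sigma_algebraC. Qed.

Let sphere_bigcup (F : (set sphere)^nat) :
  (forall i, sphere_borel (F i)) -> sphere_borel (\bigcup_i (F i)).
Proof. exact: sigma_algebra_bigcup. Qed.

HB.instance Definition _ := @isMeasurable.Build default_measure_display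
  sphere sphere_borel sphere_set0 sphere_setC sphere_bigcup.

Local Notation R3 :=
  (measurableTypeR R * measurableTypeR R * measurableTypeR R)%type.

Definition lebesgue3 : {measure set R3 -> \bar R} :=
  ((lebesgue_measure \x lebesgue_measure) \x lebesgue_measure)%E.

Definition vec3 (x : R3) : 'cV[R]_3 :=
  \col_(i < 3) [:: x.1.1; x.1.2; x.2]`_i.

Definition enorm (v : 'cV[R]_3) : R := Num.sqrt (dot v v).

(* [radial x] is x / |x|; its value at the origin is irrelevant. *)
Definition radial (x : R3) : sphere :=
  insubd north_pole ((enorm (vec3 x))^-1 *: vec3 x).

Definition unit_ball3 : set R3 := [set x | enorm (vec3 x) <= 1].

Let measurable_vec3 (i : 'I_3) : measurable_fun setT (fun x : R3 => vec3 x i 0).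
Proof.
have m11 : measurable_fun setT (fun x : R3 => x.1.1).
  by apply: (measurableT_comp (f := fst)) => //; exact: measurable_fst.
have m12 : measurable_fun setT (fun x : R3 => x.1.2).
  by apply: (measurableT_comp (f := snd)) => //; exact: measurable_fst.
have m2 : measurable_fun setT (fun x : R3 => x.2) by exact: measurable_snd.
under eq_fun do rewrite mxE.
by case: i => [[|[|[|//]]]] ?.
Qed.

Let measurable_dot (f g : R3 -> 'cV[R]_3) :
  (forall i, measurable_fun setT (fun x => f x i 0)) ->
  (forall i, measurable_fun setT (fun x => g x i 0)) ->
  measurable_fun setT (fun x => dot (f x) (g x) : measurableTypeR R).
Proof.
move=> mf mg; rewrite /dot.
by apply: measurable_sum => i; exact: measurable_funM.
Qed.

Let measurable_scaled (i : 'I_3) : measurable_fun setT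
  (fun x : R3 => ((enorm (vec3 x))^-1 *: vec3 x) i 0).
Proof.
under eq_fun => x.
  rewrite mxE /enorm -powR12_sqrt -?powRN; first over.
  by rewrite sumr_ge0// => j _; rewrite -expr2 sqr_ge0.
apply: measurable_funM; last exact: measurable_vec3.
by apply: (measurableT_comp (measurable_powR _)); exact: measurable_dot.
Qed.

Lemma measurable_radial : measurable_fun setT radial.
Proof.
have mcoord (i : 'I_3) : measurable_fun setT (sphere_coord i \o radial).
  have -> : sphere_coord i \o radial = fun x : R3 =>
      let v := (enorm (vec3 x))^-1 *: vec3 x in
      if dot v v == 1 then v i 0 else north_pole_vec i 0.
    apply/funext => x /=; rewrite /sphere_coord /radial val_insubd.
    by case: ifP.
  apply: measurable_fun_ifT => //.
    by apply: measurable_fun_eqr => //; apply: measurable_dot;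
      exact: measurable_scaled.
  exact: measurable_scaled.
have sub : g_sigma_preimage (fun i => sphere_coord i \o radial) `<=` measurable.
  apply: smallest_sub; first exact: sigma_algebra_measurable.
  rewrite -bigcup_mkord_ord; apply: bigcup_sub => k _ A [B mB <-].
  exact: mcoord.
rewrite g_sigma_preimage_comp in sub.
by move=> _ A mA; apply: sub; exists A.
Qed.

Lemma measurable_unit_ball3 : measurable unit_ball3.
Proof.
rewrite -[unit_ball3]setTI.
have -> : unit_ball3 =
    (fun x : R3 => dot (vec3 x) (vec3 x) : measurableTypeR R) @^-1` `]-oo, 1].
  apply/funext => x; apply/propext.
  have -> : unit_ball3 x = (Num.sqrt (dot (vec3 x) (vec3 x)) <= Num.sqrt 1).
    by rewrite sqrtr1.
  by rewrite ler_sqrt// /preimage/= in_itv.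
by apply: measurable_dot => //; exact: measurable_itv.
Qed.

(* Surface measure of the round metric, as the cone measure: the area of A is
   3 times the volume of the part of the unit ball lying over A (polar
   coordinates; total mass 4 pi). *)
Definition surface (A : set sphere) : \bar R :=
  (3%:E * lebesgue3 (radial @^-1` A `&` unit_ball3))%E.

Let cone : {measure set R3 -> \bar R} :=
  mscale (3 : R)%:nng (mrestr lebesgue3 measurable_unit_ball3).

Let surface0 : surface set0 = 0%E.
Proof. by rewrite /surface preimage_set0 set0I measure0 mule0. Qed.

Let surface_ge0 A : (0 <= surface A)%E.
Proof. by rewrite mule_ge0. Qed.

Let surface_sigma_additive : semi_sigma_additive surface.
Proof.
move=> F mF tF mUF.
have mpre A : measurable A -> measurable (radial @^-1` A).
  by move=> mA; rewrite -[X in measurable X]setTI; exact: measurable_radial.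
rewrite (_ : surface (\bigcup_n F n) = cone (\bigcup_n (radial @^-1` F n))).
  apply: (@measure_semi_sigma_additive _ _ _ cone) => [n||].
  - exact: mpre.
  - apply/trivIsetP => i j _ _ ij; rewrite -preimage_setI.
    by move/trivIsetP : tF => /(_ _ _ _ _ ij) ->//; rewrite preimage_set0.
  - by apply: bigcup_measurable => n _; exact: mpre.
by rewrite -preimage_bigcup.
Qed.

HB.instance Definition _ := isMeasure.Build _ _ _ surface
  surface0 surface_ge0 surface_sigma_additive.

Definition sphere_Lnorm (q : \bar R) (f : sphere -> R[i]) : \bar R :=
  Lnorm surface q (fun x => (Normc.normc (f x))%:E).

Definition geodist (x y : sphere) : R := acos (dot (val x) (val y)).

(* The closed r-neighbourhood; dist(Omega, x) is the infimum of the distances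
   from x to the points of Omega (+oo if Omega is empty). *)
Definition neighborhood (r : R) (Omega : set sphere) : set sphere :=
  [set x | (ereal_inf [set (geodist y x)%:E | y in Omega] <= r%:E)%E].

Definition great_circle (G : set sphere) : Prop :=
  exists v : sphere, G = [set x | dot (val v) (val x) = 0].

Definition SO3 (A : 'M[R]_3) : Prop := A *m A^T = 1%:M /\ \det A = 1.

(* c N^(1/4) (x_1 + i x_2)^N, as a polynomial function on R^3. *)
Definition beam0 (c : R) (N : nat) (x : 'cV[R]_3) : R[i] :=
  ((c * N%:R `^ 4^-1)%:C * (x 0 0 +i* x 1 0) ^+ N)%C.

(* The normalizing constant c = C_N is unique, and exists for N > 0. *)
Definition gaussian_beam (N : nat) (p : sphere) (Q : sphere -> R[i]) : Prop :=
  exists (c : R) (A : 'M[R]_3),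
    [/\ 0 < c,
        sphere_Lnorm 2%:E (fun x => beam0 c N (val x)) = 1%:E,
        SO3 A,
        A *m val north_pole = val p &
        forall x, Q x = beam0 c N (invmx A *m val x)].

End Sphere.

Definition beam_count (R : realType) (delta : R) (N : nat) : nat :=
  (Num.truncn (delta * Num.sqrt N%:R)).+1.

Definition separation_condition (R : realType)
    (p : forall m, 'I_m -> sphere R) : Prop :=
  exists2 c : R, 0 < c &
    forall (m : nat) (j k : 'I_m), j != k ->
      c / Num.sqrt m%:R <= geodist (p m j) (p m k).

Definition great_circle_condition (R : realType)
    (p : forall m, 'I_m -> sphere R) (L : nat -> R) : Prop :=
  forall m : nat, (0 < m)%N ->
    1 <= L m /\
    forall G : set (sphere R), great_circle G ->
      #|[pred j | p m j \in neighborhood (m%:R^-1) G]|%:R <= L m.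

Definition beam_sum (R : realType) (m : nat) (Q : 'I_m -> sphere R -> R[i]) :
    sphere R -> R[i] :=
  fun x => \sum_(j < m) Q j x.

Definition L2_normalize (R : realType) (f : sphere R -> R[i]) :
    sphere R -> R[i] :=
  fun x => f x / (fine (sphere_Lnorm 2%:E f))%:C%C.

(* Main.v *)
From HB Require Import structures.
Require Import Defs.
From mathcomp Require Import all_boot all_order all_algebra.
From mathcomp Require Import all_classical all_reals all_analysis.
From mathcomp Require Import measurable_realfun ess_sup_inf.
From mathcomp Require Import cyclic separable cyclotomic.
From mathcomp Require Import complex ring lra.

Import Order.TTheory GRing.Theory Num.Theory.
Import numFieldNormedType.Exports.

(* Put a := |(x_1 + i x_2)^N|_2^-1, so that Q_j has modulus
   a (1 - <x, p_j>^2)^(N/2).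

   L^2 bound. The cone measure is invariant under SO(3): Lebesgue measure is
   invariant under shears, and plane rotations are products of three shears.
   Averaging over the rotations about the pole of Q_j annihilates every
   component of Q_k of a different weight, which gives
   |<Q_j, Q_k>| = ((1 + <p_j, p_k>) / 2)^N. By separation this is at most
   exp(- c sqrt N) for j != k, whence |F_N|_2^2 >= m / 2.

   Sup bound. A point p with |<x, p>| <= k / m lies within 1 / m of one of O(k)
   great circles depending on x only, so there are O(k L) such p_j. Since
   N >= m^2, the value |Q_j(x)| is at most a exp(- k^2 / 2) when
   |<x, p_j>| >= k / m, and summing over k gives |F_N(x)| <= a O(L).

   Finally the mass of |x_1 + i x_2|^(2N) near the equator gives
   a^2 = O(sqrt N) = O(m / delta). *)

Set Implicit Arguments.
Unset Strict Implicit.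
Unset Printing Implicit Defensive.

Local Open Scope classical_set_scope.
Local Open Scope ring_scope.

(** * Shears and plane rotations of space *)

(** Integration over the rotation group is avoided. The integrand of <Q_j, Q_k> has only the weights
    -2N, ..., 0 under rotations about the pole of Q_j, so averaging over the 2N + 1 rotations by
    roots of unity already separates them, and a finite sum of integrals does the work of a Fubini
    argument. The bound must not depend on the separation constant c. It enters only through the
    off-diagonal overlaps, hence only through how large N has to be. The relation N >= m^2 says that
    the width N^(-1/2) of a beam is at most the width 1 / m in (G); this is what dictates delta_0 =
    1 / 2. The constant C_N is never evaluated: normalization makes C_N N^(1/4) the inverse square
    root of an integral, of which only a lower bound is used. Exponentials are compared with
    rational functions through 1 + x <= exp x, so the final sum over k telescopes. *)

Lemma lebesgue_measureD (R : realType) (a : R) (A : set (measurableTypeR R)) :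
  measurable A ->
  lebesgue_measure ((fun x : measurableTypeR R => x + a) @^-1` A) =
  lebesgue_measure A.
Proof.
move=> mA.
have mf : measurable_fun setT
    (fun x : measurableTypeR R => x + a : measurableTypeR R).
  exact: measurable_funD.
rewrite [RHS](@lebesgue_measure_unique R
  (measure_function_pushforward__canonical__measure_function_Measure
    lebesgue_measure mf)) //.
move=> _ [[b c]] _ <-; rewrite /= /pushforward.
rewrite (_ : _ @^-1` _ = [set` `]b - a, c - a]]); last first.
  by apply/seteqP; split => x /=; rewrite !in_itv /= lerBrDr ltrBlDr.
rewrite !lebesgue_measure_itv /= !lte_fin ltrD2r.
by case: ifP => // _; rewrite -!EFinB; congr EFin; ring.
Qed.

(** The product measure integrates over x the [m2]-measure of the x-section, and the x-section of
    the preimage is the preimage under [h x] of the x-section. *)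
Lemma product_measure1_preimage_snd d1 d2 (T1 : measurableType d1)
    (T2 : measurableType d2) (R : realType) (m1 : {measure set T1 -> \bar R})
    (m2 : {sigma_finite_measure set T2 -> \bar R}) (h : T1 -> T2 -> T2) :
  (forall x A, measurable A -> m2 (h x @^-1` A) = m2 A) ->
  forall E, measurable E ->
  (m1 \x m2)%E ((fun z => (z.1, h z.1 z.2)) @^-1` E) = (m1 \x m2)%E E.
Proof.
move=> hm2 E mE; apply: eq_integral => x _ /=.
rewrite -[RHS](hm2 x); last exact: measurable_xsection.
by congr (m2 _); rewrite /xsection; apply/funext => y; apply/propext; rewrite /= !inE.
Qed.

Lemma product_measure1_sigma_finite d1 d2 (T1 : measurableType d1)
    (T2 : measurableType d2) (R : realType)
    (m1 : {sigma_finite_measure set T1 -> \bar R})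
    (m2 : {sigma_finite_measure set T2 -> \bar R}) :
  sigma_finite setT (m1 \x m2)%E.
Proof.
have /sigma_finiteP[F [UF ndF Ffin]] := sigma_finiteT m1.
have /sigma_finiteP[G [UG ndG Gfin]] := sigma_finiteT m2.
exists (fun n => F n `*` G n) => [|n].
  apply/seteqP; split => // -[x y] _.
  have [i _ Fx] : (\bigcup_i F i) x by rewrite -UF.
  have [j _ Gy] : (\bigcup_i G i) y by rewrite -UG.
  exists (i + j)%N => //; split => /=.
    by move: x Fx; exact/subsetPset/ndF/leq_addr.
  by move: y Gy; exact/subsetPset/ndG/leq_addl.
have [[mF Foo] [mG Goo]] := (Ffin n, Gfin n).
split; first exact: measurableX.
by rewrite product_measure1E// lte_mul_pinfty// ge0_fin_numE.
Qed.

(** The product measure is defined by x-sections, while here the y-sections are preserved.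
    Uniqueness of product measures passes to the other order of integration; joint measurability of
    [h] makes the preimage a set to which this applies. *)
Lemma product_measure1_preimage_fst d1 d2 (T1 : measurableType d1)
    (T2 : measurableType d2) (R : realType)
    (m1 : {sigma_finite_measure set T1 -> \bar R})
    (m2 : {sigma_finite_measure set T2 -> \bar R}) (h : T2 -> T1 -> T1) :
  measurable_fun setT (fun z => h z.2 z.1) ->
  (forall y A, measurable A -> m1 (h y @^-1` A) = m1 A) ->
  forall E, measurable E ->
  (m1 \x m2)%E ((fun z => (h z.2 z.1, z.2)) @^-1` E) = (m1 \x m2)%E E.
Proof.
move=> mh hm1 E mE.
have m12 X : measurable X -> (m1 \x m2)%E X = (m1 \x^ m2)%E X.
  move=> mX; apply: product_measure_unique => // A B mA mB /=.
  by rewrite product_measure2E.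
have mf : measurable_fun setT (fun z : T1 * T2 => (h z.2 z.1, z.2)).
  by apply: measurable_fun_pair => //; exact: measurable_snd.
rewrite !m12 //; last by rewrite -[X in measurable X]setTI; exact: mf.
apply: eq_integral => y _ /=.
rewrite -[RHS](hm1 y); last exact: measurable_ysection.
by congr (m1 _); rewrite /ysection; apply/funext => x; apply/propext; rewrite /= !inE.
Qed.

Section Lebesgue3.
Variable R : realType.
Local Notation T := (measurableTypeR R).
Local Notation R3 := (T * T * T)%type.

Definition preserves_lebesgue3 (f : R3 -> R3) : Prop :=
  measurable_fun setT f /\
  forall A, measurable A -> lebesgue3 R (f @^-1` A) = lebesgue3 R A.

Lemma preserves_lebesgue3_comp f g : preserves_lebesgue3 f ->
  preserves_lebesgue3 g -> preserves_lebesgue3 (f \o g).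
Proof.
move=> [mf pf] [mg pg]; split; first exact: measurableT_comp.
move=> A mA; rewrite comp_preimage pg ?pf//.
by rewrite -[X in measurable X]setTI; exact: mf.
Qed.

Lemma measurable_fun_R3 (f1 f2 f3 : R3 -> T) : measurable_fun setT f1 ->
  measurable_fun setT f2 -> measurable_fun setT f3 ->
  measurable_fun setT (fun x => (f1 x, f2 x, f3 x)).
Proof.
by move=> m1 m2 m3; do 2![apply: measurable_fun_pair => //].
Qed.

Lemma measurable_R3_1 : measurable_fun setT (fun x : R3 => x.1.1).
Proof. by apply: (measurableT_comp (f := fst)) => //; exact: measurable_fst. Qed.

Lemma measurable_R3_2 : measurable_fun setT (fun x : R3 => x.1.2).
Proof. by apply: (measurableT_comp (f := snd)) => //; exact: measurable_fst. Qed.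

Lemma measurable_R3_3 : measurable_fun setT (fun x : R3 => x.2).
Proof. exact: measurable_snd. Qed.

Local Hint Resolve measurable_R3_1 measurable_R3_2 measurable_R3_3 : core.

(** Named so that a sigma-finite structure can be attached to it; the plane can then serve as the
    first factor of space. *)
Definition lebesgue2 : set (T * T) -> \bar R :=
  (lebesgue_measure \x lebesgue_measure)%E.

HB.instance Definition _ := Measure.on lebesgue2.
HB.instance Definition _ := Measure_isSigmaFinite.Build _ _ _ lebesgue2
  (product_measure1_sigma_finite lebesgue_measure lebesgue_measure).

Lemma lebesgue2_shear12 (a : R) (A : set (T * T)) : measurable A ->
  lebesgue2 ((fun x : T * T => (x.1, x.2 + a * x.1)) @^-1` A) = lebesgue2 A.
Proof.
move=> mA; apply: (@product_measure1_preimage_snd _ _ T T R lebesgue_measure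
  lebesgue_measure (fun x y => y + a * x)) => // x B mB.
exact: lebesgue_measureD.
Qed.

Lemma lebesgue2_shear21 (a : R) (A : set (T * T)) : measurable A ->
  lebesgue2 ((fun x : T * T => (x.1 + a * x.2, x.2)) @^-1` A) = lebesgue2 A.
Proof.
move=> mA; apply: (@product_measure1_preimage_fst _ _ T T R lebesgue_measure
  lebesgue_measure (fun y x => x + a * y)) => //.
  by apply: measurable_funD => //; exact: measurable_funM.
by move=> y B mB; exact: lebesgue_measureD.
Qed.

Lemma lebesgue2_translate2 (a : R) (A : set (T * T)) : measurable A ->
  lebesgue2 ((fun x : T * T => (x.1, x.2 + a)) @^-1` A) = lebesgue2 A.
Proof.
move=> mA; apply: (@product_measure1_preimage_snd _ _ T T R lebesgue_measure
  lebesgue_measure (fun x y => y + a)) => // x B mB.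
exact: lebesgue_measureD.
Qed.

Lemma preserves_shear12 (a : R) :
  preserves_lebesgue3 (fun x => (x.1.1, x.1.2 + a * x.1.1, x.2)).
Proof.
have m : measurable_fun setT (fun x : R3 => x.1.2 + a * x.1.1).
  by apply: measurable_funD => //; exact: measurable_funM.
split=> [|A mA]; first exact: measurable_fun_R3.
apply: (@product_measure1_preimage_fst _ _ (T * T)%type T R
  lebesgue2 lebesgue_measure
  (fun _ z => (z.1, z.2 + a * z.1))) => //.
- exact: measurable_fun_pair.
- by move=> _ B mB; exact: lebesgue2_shear12.
Qed.

Lemma preserves_shear21 (a : R) :
  preserves_lebesgue3 (fun x => (x.1.1 + a * x.1.2, x.1.2, x.2)).
Proof.
have m : measurable_fun setT (fun x : R3 => x.1.1 + a * x.1.2).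
  by apply: measurable_funD => //; exact: measurable_funM.
split=> [|A mA]; first exact: measurable_fun_R3.
apply: (@product_measure1_preimage_fst _ _ (T * T)%type T R
  lebesgue2 lebesgue_measure
  (fun _ z => (z.1 + a * z.2, z.2))) => //.
- exact: measurable_fun_pair.
- by move=> _ B mB; exact: lebesgue2_shear21.
Qed.

(** On each plane x_3 = y the map is a translation along the second axis. *)
Lemma preserves_shear32 (a : R) :
  preserves_lebesgue3 (fun x => (x.1.1, x.1.2 + a * x.2, x.2)).
Proof.
have m : measurable_fun setT (fun x : R3 => x.1.2 + a * x.2).
  by apply: measurable_funD => //; exact: measurable_funM.
split=> [|A mA]; first exact: measurable_fun_R3.
apply: (@product_measure1_preimage_fst _ _ (T * T)%type T R
  lebesgue2 lebesgue_measure
  (fun y z => (z.1, z.2 + a * y))) => //.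
- exact: measurable_fun_pair.
- by move=> y B mB; exact: lebesgue2_translate2.
Qed.

Lemma preserves_shear23 (a : R) :
  preserves_lebesgue3 (fun x => (x.1.1, x.1.2, x.2 + a * x.1.2)).
Proof.
have m : measurable_fun setT (fun x : R3 => x.2 + a * x.1.2).
  by apply: measurable_funD => //; exact: measurable_funM.
split=> [|A mA]; first exact: measurable_fun_R3.
rewrite (_ : (fun x : R3 => _) = (fun x : R3 => (x.1, x.2 + a * x.1.2))); last first.
  by apply/funext => -[[? ?] ?].
apply: (@product_measure1_preimage_snd _ _ (T * T)%type T R
  lebesgue2 lebesgue_measure
  (fun z y => y + a * z.2)) => //.
by move=> z B mB; exact: lebesgue_measureD.
Qed.

(* (c, -s; s, c) = (1, a; 0, 1) (1, 0; s, 1) (1, a; 0, 1), a = (c - 1) / s;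
   for s = 0 it is a product of two rotations with s != 0. *)
Lemma preserves_rotation12 (c s : R) : c ^+ 2 + s ^+ 2 = 1 ->
  preserves_lebesgue3
    (fun x => (c * x.1.1 - s * x.1.2, s * x.1.1 + c * x.1.2, x.2)).
Proof.
have key (c' s' : R) : s' != 0 -> c' ^+ 2 + s' ^+ 2 = 1 ->
  preserves_lebesgue3
    (fun x => (c' * x.1.1 - s' * x.1.2, s' * x.1.1 + c' * x.1.2, x.2)).
  move=> s0 cs; pose a := (c' - 1) / s'.
  rewrite (_ : (fun x => _) =
      (fun x : R3 => (x.1.1 + a * x.1.2, x.1.2, x.2)) \o
      ((fun x : R3 => (x.1.1, x.1.2 + s' * x.1.1, x.2)) \o
       (fun x : R3 => (x.1.1 + a * x.1.2, x.1.2, x.2)))); last first.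
    apply/funext => -[[x y] z] /=.
    have as' : a * s' = c' - 1 by rewrite /a mulfVK.
    have ac : a * (c' + 1) = - s'.
      rewrite /a mulrAC (_ : (c' - 1) * (c' + 1) = - s' * s') ?mulfK//.
      by lra.
    have ex : a * s' * x = (c' - 1) * x by rewrite as'.
    have ey : a * s' * y = (c' - 1) * y by rewrite as'.
    have eay : a * s' * a * y = (c' - 1) * a * y by rewrite as'.
    have ecy : a * (c' + 1) * y = - s' * y by rewrite ac.
    by congr (_, _, _); lra.
  by do !apply: preserves_lebesgue3_comp;
    [exact: preserves_shear21|exact: preserves_shear12|exact: preserves_shear21].
move=> cs; have [s0|] := eqVneq s 0; last by move=> /key; exact.
have := preserves_lebesgue3_comp (key 0 c _ _) (key 0 (-1) _ _).
have c2 : c ^+ 2 = 1 by rewrite -cs s0 expr0n addr0.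
have c0 : c != 0.
  by apply/eqP => c0; move: c2; rewrite c0 expr0n /= => /eqP; rewrite eq_sym oner_eq0.
move=> /(_ c0) H.
rewrite (_ : (fun x => _) =
  (fun x : R3 => (0 * x.1.1 - c * x.1.2, c * x.1.1 + 0 * x.1.2, x.2)) \o
  (fun x : R3 => (0 * x.1.1 - -1 * x.1.2, -1 * x.1.1 + 0 * x.1.2, x.2))).
  by apply: H; rewrite ?oppr_eq0 ?oner_eq0// expr0n add0r// sqrrN expr1n.
by apply/funext => -[[x y] z] /=; rewrite s0; congr (_, _, _); ring.
Qed.

(** The same factorization into three shears, in the last two coordinates. *)
Lemma preserves_rotation23 (c s : R) : c ^+ 2 + s ^+ 2 = 1 ->
  preserves_lebesgue3
    (fun x => (x.1.1, c * x.1.2 - s * x.2, s * x.1.2 + c * x.2)).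
Proof.
have key (c' s' : R) : s' != 0 -> c' ^+ 2 + s' ^+ 2 = 1 ->
  preserves_lebesgue3
    (fun x => (x.1.1, c' * x.1.2 - s' * x.2, s' * x.1.2 + c' * x.2)).
  move=> s0 cs; pose a := (c' - 1) / s'.
  rewrite (_ : (fun x => _) =
      (fun x : R3 => (x.1.1, x.1.2 + a * x.2, x.2)) \o
      ((fun x : R3 => (x.1.1, x.1.2, x.2 + s' * x.1.2)) \o
       (fun x : R3 => (x.1.1, x.1.2 + a * x.2, x.2)))); last first.
    apply/funext => -[[z x] y] /=.
    have as' : a * s' = c' - 1 by rewrite /a mulfVK.
    have ac : a * (c' + 1) = - s'.
      rewrite /a mulrAC (_ : (c' - 1) * (c' + 1) = - s' * s') ?mulfK//.
      by lra.
    have ex : a * s' * x = (c' - 1) * x by rewrite as'.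
    have ey : a * s' * y = (c' - 1) * y by rewrite as'.
    have eay : a * s' * a * y = (c' - 1) * a * y by rewrite as'.
    have ecy : a * (c' + 1) * y = - s' * y by rewrite ac.
    by congr (_, _, _); lra.
  by do !apply: preserves_lebesgue3_comp;
    [exact: preserves_shear32|exact: preserves_shear23|exact: preserves_shear32].
move=> cs; have [s0|] := eqVneq s 0; last by move=> /key; exact.
have := preserves_lebesgue3_comp (key 0 c _ _) (key 0 (-1) _ _).
have c2 : c ^+ 2 = 1 by rewrite -cs s0 expr0n addr0.
have c0 : c != 0.
  by apply/eqP => c0; move: c2; rewrite c0 expr0n /= => /eqP; rewrite eq_sym oner_eq0.
move=> /(_ c0) H.
rewrite (_ : (fun x => _) =
  (fun x : R3 => (x.1.1, 0 * x.1.2 - c * x.2, c * x.1.2 + 0 * x.2)) \o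
  (fun x : R3 => (x.1.1, 0 * x.1.2 - -1 * x.2, -1 * x.1.2 + 0 * x.2))).
  by apply: H; rewrite ?oppr_eq0 ?oner_eq0// expr0n add0r// sqrrN expr1n.
by apply/funext => -[[x y] z] /=; rewrite s0; congr (_, _, _); ring.
Qed.

End Lebesgue3.

(** * Rotations of space *)

Lemma sum_I3 (V : nmodType) (F : 'I_3 -> V) :
  \sum_(i < 3) F i = F 0 + F 1 + F 2%:R.
Proof.
by rewrite !big_ord_recr big_ord0 /= add0r; congr (F _ + F _ + F _); exact/val_inj.
Qed.

Lemma forall_I3 (P : 'I_3 -> Prop) : P 0 -> P 1 -> P 2%:R -> forall i, P i.
Proof.
move=> P0 P1 P2 [[|[|[|//]]] i3].
- by rewrite (_ : Ordinal _ = 0)//; exact/val_inj.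
- by rewrite (_ : Ordinal _ = 1)//; exact/val_inj.
- by rewrite (_ : Ordinal _ = 2%:R)//; exact/val_inj.
Qed.

Lemma det_mx22 (R : comPzRingType) (M : 'M[R]_2) :
  \det M = M 0 0 * M 1 1 - M 0 1 * M 1 0.
Proof.
rewrite (expand_det_row _ 0) !big_ord_recl big_ord0 addr0 /cofactor !det_mx11.
rewrite !mxE /= addn0 expr0 expr1 !mul1r mulN1r mulrN.
by congr (_ * _ - _ * _); congr (M _ _); exact/val_inj.
Qed.

Section RotationInvariance.
Variable R : realType.
Local Notation T := (measurableTypeR R).
Local Notation R3 := (T * T * T)%type.
Implicit Types (A B : 'M[R]_3) (v w : 'cV[R]_3).

Lemma dotE v w : dot v w = v 0 0 * w 0 0 + v 1 0 * w 1 0 + v 2%:R 0 * w 2%:R 0.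
Proof. exact: sum_I3. Qed.

Lemma vec3E (x : R3) :
  ((vec3 x 0 0 = x.1.1) * (vec3 x 1 0 = x.1.2) * (vec3 x 2%:R 0 = x.2))%type.
Proof. by rewrite /vec3 !mxE. Qed.

Definition mx_act A (x : R3) : R3 :=
  let v := A *m vec3 x in (v 0 0, v 1 0, v 2%:R 0).

Lemma vec3_mx_act A x : vec3 (mx_act A x) = A *m vec3 x.
Proof.
apply/matrixP => i j; rewrite ord1 {j}; move: i.
by apply: forall_I3; rewrite vec3E.
Qed.

Lemma mx_actM A B : mx_act (A *m B) = mx_act A \o mx_act B.
Proof. by apply/funext => x; rewrite /mx_act /= vec3_mx_act mulmxA. Qed.

Lemma mx_actE A x : mx_act A x =
  (A 0 0 * x.1.1 + A 0 1 * x.1.2 + A 0 2%:R * x.2,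
   A 1 0 * x.1.1 + A 1 1 * x.1.2 + A 1 2%:R * x.2,
   A 2%:R 0 * x.1.1 + A 2%:R 1 * x.1.2 + A 2%:R 2%:R * x.2).
Proof. by rewrite /mx_act !mxE !sum_I3 !vec3E. Qed.

Lemma SO3_tr_mul A : SO3 A -> A^T *m A = 1%:M.
Proof. by case=> /mulmx1C. Qed.

Lemma SO3_invmx A : SO3 A -> invmx A = A^T.
Proof.
move=> [AAt _]; have [Au _] := mulmx1_unit AAt.
by rewrite -[RHS]mul1mx -(mulVmx Au) -mulmxA AAt mulmx1.
Qed.

Lemma SO3_tr A : SO3 A -> SO3 A^T.
Proof. by move=> sA; split; rewrite ?trmxK ?SO3_tr_mul// det_tr; case: sA. Qed.

Lemma SO3_mul A B : SO3 A -> SO3 B -> SO3 (A *m B).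
Proof.
move=> [A1 A2] [B1 B2]; split; last by rewrite det_mulmx A2 B2 mulr1.
by rewrite trmx_mul mulmxA -(mulmxA A) B1 mulmx1.
Qed.

(** Determinant 1 makes the inverse, which is the transpose, equal to the adjugate; the identity
    compares their last diagonal entries. This is how orientation enters the computations. *)
Lemma SO3_cofactor A : SO3 A -> A 0 0 * A 1 1 - A 0 1 * A 1 0 = A 2%:R 2%:R.
Proof.
move=> sA; have [AAt dA] := sA.
have At : A^T = (\adj A).
  by rewrite -[RHS]mul1mx -(SO3_tr_mul sA) -mulmxA mul_mx_adj dA mulmx1.
have := congr1 (fun M : 'M[R]_3 => M 2%:R 2%:R) At; rewrite !mxE => ->.
rewrite /cofactor det_mx22 -signr_odd /= expr0 mul1r !mxE.
by congr (_ * _ - _ * _); congr (A _ _); exact/val_inj.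
Qed.

Lemma SO3_row A : SO3 A -> forall i j,
  A i 0 * A j 0 + A i 1 * A j 1 + A i 2%:R * A j 2%:R = (i == j)%:R.
Proof.
move=> [AAt _] i j; have := congr1 (fun M : 'M[R]_3 => M i j) AAt.
by rewrite !mxE sum_I3 !mxE.
Qed.

(** The last row and column are unit vectors with last entry 1, so the other entries vanish and a
    plane rotation remains. *)
Lemma preserves_SO3_fix3 A : SO3 A -> A 2%:R 2%:R = 1 ->
  preserves_lebesgue3 (mx_act A).
Proof.
move=> sA A22; have rA := SO3_row sA; have cA := SO3_cofactor sA.
have r00 : _ = 1 := rA 0 0; have r11 : _ = 1 := rA 1 1.
have r22 : _ = 1 := rA 2%:R 2%:R.
have r02 : _ = 0 := rA 0 2%:R; have r12 : _ = 0 := rA 1 2%:R.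
have sqr0 (a b : R) : a ^+ 2 + b ^+ 2 = 0 -> a = 0 /\ b = 0.
  by move=> /eqP; rewrite paddr_eq0 ?sqr_ge0// !sqrf_eq0 => /andP[/eqP-> /eqP->].
have [A20 A21] : A 2%:R 0 = 0 /\ A 2%:R 1 = 0 by apply: sqr0; nra.
have A02 : A 0 2%:R = 0 by move: r02; rewrite A20 A21 A22; lra.
have A12 : A 1 2%:R = 0 by move: r12; rewrite A20 A21 A22; lra.
(* The sum of the two squares is the squared norm of the upper block minus twice its determinant, 2
   - 2 = 0. *)
have [A11 A10] : A 1 1 - A 0 0 = 0 /\ A 1 0 + A 0 1 = 0.
  by apply: sqr0; rewrite A02 A12 A22 in r00 r11 cA; lra.
have -> : mx_act A = fun x =>
    (A 0 0 * x.1.1 - A 1 0 * x.1.2, A 1 0 * x.1.1 + A 0 0 * x.1.2, x.2).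
  apply/funext => x; rewrite mx_actE A20 A21 A02 A12 A22.
  rewrite (subr0_eq A11) -(addr0_eq A10); congr (_, _, _); ring.
by apply: preserves_rotation12; rewrite -r00 A02 -(addr0_eq A10); ring.
Qed.

Definition mx3 (a00 a01 a02 a10 a11 a12 a20 a21 a22 : R) : 'M[R]_3 :=
  \matrix_(i < 3, j < 3)
    nth 0 (nth [::]
      [:: [:: a00; a01; a02]; [:: a10; a11; a12]; [:: a20; a21; a22]] i) j.

Lemma SO3_mx3_12 (c s : R) : c ^+ 2 + s ^+ 2 = 1 ->
  SO3 (mx3 c (- s) 0 s c 0 0 0 1).
Proof.
move=> cs; split.
  apply/matrixP => i j; rewrite mxE sum_I3 !mxE.
  by move: i j; apply: forall_I3; apply: forall_I3 => /=; lra.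
rewrite (expand_det_row _ 2%:R) sum_I3 !mxE /= !mul0r !add0r mul1r.
by rewrite /cofactor det_mx22 -signr_odd !mxE /=; lra.
Qed.

Lemma SO3_mx3_23 (c s : R) : c ^+ 2 + s ^+ 2 = 1 ->
  SO3 (mx3 1 0 0 0 c (- s) 0 s c).
Proof.
move=> cs; split.
  apply/matrixP => i j; rewrite mxE sum_I3 !mxE.
  by move: i j; apply: forall_I3; apply: forall_I3 => /=; lra.
rewrite (expand_det_row _ 0) sum_I3 !mxE /= !mul0r !addr0 mul1r.
by rewrite /cofactor det_mx22 -signr_odd !mxE /=; lra.
Qed.

Lemma preserves_mx3_12 (c s : R) : c ^+ 2 + s ^+ 2 = 1 ->
  preserves_lebesgue3 (mx_act (mx3 c (- s) 0 s c 0 0 0 1)).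
Proof.
move=> cs; rewrite (_ : mx_act _ = fun x =>
    (c * x.1.1 - s * x.1.2, s * x.1.1 + c * x.1.2, x.2)).
  exact: preserves_rotation12.
by apply/funext => x; rewrite mx_actE !mxE /=; congr (_, _, _); lra.
Qed.

Lemma preserves_mx3_23 (c s : R) : c ^+ 2 + s ^+ 2 = 1 ->
  preserves_lebesgue3 (mx_act (mx3 1 0 0 0 c (- s) 0 s c)).
Proof.
move=> cs; rewrite (_ : mx_act _ = fun x =>
    (x.1.1, c * x.1.2 - s * x.2, s * x.1.2 + c * x.2)).
  exact: preserves_rotation23.
by apply/funext => x; rewrite mx_actE !mxE /=; congr (_, _, _); lra.
Qed.

(** The rotation turns (a, b) into (0, r). Only the square of r is specified, so the caller may have
    to fix a sign. *)
Lemma rotate_to_axis (a b : R) : exists c s r : R,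
  [/\ c ^+ 2 + s ^+ 2 = 1, r ^+ 2 = a ^+ 2 + b ^+ 2,
      c * a - s * b = 0 & s * a + c * b = r].
Proof.
pose r := Num.sqrt (a ^+ 2 + b ^+ 2).
have r2 : r ^+ 2 = a ^+ 2 + b ^+ 2 by rewrite sqr_sqrtr// addr_ge0 ?sqr_ge0.
have [r0|r0] := eqVneq r 0.
  exists 1, 0, 0; move: r2; rewrite r0 expr0n /= => /esym ab0.
  move: (ab0) => /eqP; rewrite paddr_eq0 ?sqr_ge0// !sqrf_eq0 => /andP[/eqP-> /eqP->].
  by split; ring.
exists (b / r), (a / r), r; split=> //; last 2 first.
- by field.
- by transitivity ((a ^+ 2 + b ^+ 2) / r); [field|rewrite -r2; field].
by rewrite !expr_div_n -mulrDl addrC -r2 divff// sqrf_eq0.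
Qed.

(* Givens: two plane rotations bring the third column to (0, 0, 1). *)
Lemma preserves_SO3 A : SO3 A -> preserves_lebesgue3 (mx_act A).
Proof.
move=> sA.
have [c [s [r [cs r2 e1 e2]]]] := rotate_to_axis (A 0 2%:R) (A 1 2%:R).
have [c' [s' [r' [cs' r2' e1' e2']]]] := rotate_to_axis r (A 2%:R 2%:R).
have At : _ = 1 := SO3_row (SO3_tr sA) 2%:R 2%:R; rewrite !mxE in At.
have r1 : r' ^+ 2 = 1 by rewrite r2' r2 -At; lra.
(* When r' = -1, replacing (c', s') by its opposite, which is still a rotation, changes the sign of
   r'. *)
wlog r'1 : c' s' r' cs' r2' e1' e2' r1 / r' = 1.
  move=> H; have /eqP := r1; rewrite sqrf_eq1 => /orP[/eqP|/eqP] r'E.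
    exact: (H c' s' r').
  apply: (H (- c') (- s') (- r')) => //; rewrite ?sqrrN//; last 1 first.
  - by rewrite r'E opprK.
  - by lra.
  - by lra.
pose G := mx3 c (- s) 0 s c 0 0 0 1.
pose G' := mx3 1 0 0 0 c' (- s') 0 s' c'.
have sG : SO3 G by exact: SO3_mx3_12.
have sG' : SO3 G' by exact: SO3_mx3_23.
pose B := G' *m (G *m A).
have sB : SO3 B by do 2!apply: SO3_mul => //.
(* The inverses of [G] and [G'] are their transposes, again plane rotations, with the opposite sine.
   What remains, [B], has corner entry s' r + c' a_33 = r' = 1. *)
have -> : A = mx3 c (- - s) 0 (- s) c 0 0 0 1 *m
    (mx3 1 0 0 0 c' (- - s') 0 (- s') c' *m B).
  have tr12 : mx3 c (- - s) 0 (- s) c 0 0 0 1 = G^T.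
    apply/matrixP => i j; rewrite !mxE; move: i j.
    by apply: forall_I3; apply: forall_I3 => /=; rewrite ?opprK.
  have tr23 : mx3 1 0 0 0 c' (- - s') 0 (- s') c' = G'^T.
    apply/matrixP => i j; rewrite !mxE; move: i j.
    by apply: forall_I3; apply: forall_I3 => /=; rewrite ?opprK.
  by rewrite tr12 tr23 /B (mulmxA G'^T) SO3_tr_mul// mul1mx mulmxA SO3_tr_mul// mul1mx.
rewrite 2!mx_actM; do 2?apply: preserves_lebesgue3_comp.
- by apply: preserves_mx3_12; rewrite sqrrN.
- by apply: preserves_mx3_23; rewrite sqrrN.
apply: preserves_SO3_fix3 => //.
rewrite /B mxE sum_I3 ![(G *m A) _ _]mxE !sum_I3 !mxE /=.
by rewrite -[RHS]r'1 -e2' -e2; ring.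
Qed.

End RotationInvariance.

(** * Rotations of the sphere *)

Section SphereRotation.
Variable R : realType.
Local Notation T := (measurableTypeR R).
Local Notation R3 := (T * T * T)%type.
Implicit Types (A B : 'M[R]_3) (v w : 'cV[R]_3) (x y : sphere R).

Lemma dotC v w : dot v w = dot w v.
Proof. by rewrite !dotE; ring. Qed.

Lemma dotDl u v w : dot (u + v) w = dot u w + dot v w.
Proof. by rewrite !dotE !mxE; ring. Qed.

Lemma dotZl a v w : dot (a *: v) w = a * dot v w.
Proof. by rewrite !dotE !mxE; ring. Qed.

Lemma dotZr a v w : dot v (a *: w) = a * dot v w.
Proof. by rewrite !dotE !mxE; ring. Qed.

Lemma dot_ge0 v : 0 <= dot v v.
Proof. by rewrite dotE !addr_ge0// -expr2 sqr_ge0. Qed.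

Lemma dot_eq0 v : dot v v = 0 -> v = 0.
Proof.
rewrite dotE => /eqP; rewrite -!expr2 !paddr_eq0 ?addr_ge0 ?sqr_ge0//.
rewrite !sqrf_eq0 => /andP[/andP[/eqP v0 /eqP v1] /eqP v2].
by apply/matrixP => i j; rewrite ord1 mxE; move: i; exact: forall_I3.
Qed.

Lemma dot_sphere x : dot (val x) (val x) = 1.
Proof. exact/eqP/(valP x). Qed.

Lemma sphere_coord_le1 x i : `|val x i 0| <= 1.
Proof.
rewrite -(@expr_le1 _ 2)// real_normK ?num_real//.
apply: (@le_trans _ _ (dot (val x) (val x))); last by rewrite dot_sphere.
rewrite dotE -!expr2; have s j := sqr_ge0 (val x j 0).
by move: i; apply: forall_I3; move: (s 0) (s 1) (s 2%:R); lra.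
Qed.

Lemma dot_mulmx A v w : dot (A *m v) w = dot v (A^T *m w).
Proof. by rewrite !dotE !mxE !sum_I3 !mxE; ring. Qed.

Lemma dot_SO3 A v w : SO3 A -> dot (A *m v) (A *m w) = dot v w.
Proof. by move=> sA; rewrite dot_mulmx mulmxA SO3_tr_mul// mul1mx. Qed.

(** Total in the matrix; under [SO3 A] the default value is never taken. *)
Definition rotate A x : sphere R := insubd (north_pole R) (A *m val x).

Lemma val_rotate A x : SO3 A -> val (rotate A x) = A *m val x.
Proof. by move=> sA; rewrite val_insubd dot_SO3// (valP x). Qed.

Lemma measurable_sphere_coord (i : 'I_3) : measurable_fun setT (@sphere_coord R i).
Proof.
move=> _ B mB; apply: sub_sigma_algebra.
rewrite -bigcup_mkord_ord; exists i => //=.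
by exists B => //; rewrite (_ : inord i = i)//; exact: inord_val.
Qed.

Lemma measurable_fun_sphere d (U : measurableType d) (f : U -> sphere R) :
  (forall i, measurable_fun setT (@sphere_coord R i \o f)) -> measurable_fun setT f.
Proof.
move=> mcoord.
have sub : g_sigma_preimage (fun i => @sphere_coord R i \o f) `<=` measurable.
  apply: smallest_sub; first exact: sigma_algebra_measurable.
  rewrite -bigcup_mkord_ord; apply: bigcup_sub => k _ A [B mB <-].
  exact: mcoord.
rewrite g_sigma_preimage_comp in sub.
by move=> _ A mA; apply: sub; exists A.
Qed.

Lemma measurable_rotate A : SO3 A -> measurable_fun setT (rotate A).
Proof.
move=> sA; apply: measurable_fun_sphere => i.
rewrite (_ : _ \o _ = fun x => A i 0 * sphere_coord 0 x +
    A i 1 * sphere_coord 1 x + A i 2%:R * sphere_coord 2%:R x).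
  by do !apply: measurable_funD; apply: measurable_funM => //;
    exact: measurable_sphere_coord.
by apply/funext => x; rewrite /= /sphere_coord val_rotate// mxE sum_I3.
Qed.

(** [radial] has an arbitrary value at the origin and commutes with rotations only away from it. The
    origin is therefore removed, at no cost in volume, before cones are compared. *)
Let origin : set R3 := [set x | vec3 x = 0].

Let originE : origin = [set 0] `*` [set 0] `*` [set 0].
Proof.
apply/seteqP; split => [[[x y] z] e|[[x y] z] /= [[-> ->] ->]].
  have e' i : vec3 (x, y, z) i 0 = 0 by rewrite e mxE.
  by have := (e' 0, e' 1, e' 2%:R); rewrite !vec3E /= => -[[-> ->] ->].
rewrite /origin /=; apply/matrixP => i j; rewrite ord1 [RHS]mxE; move: i.
by apply: forall_I3; rewrite vec3E.
Qed.

Let measurable_origin : measurable origin.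
Proof. by rewrite originE; do 2?apply: measurableX => //; exact: measurable_set1. Qed.

Lemma lebesgue3_box (X Y Z : set T) :
  measurable X -> measurable Y -> measurable Z ->
  lebesgue3 R (X `*` Y `*` Z) =
  (lebesgue_measure X * lebesgue_measure Y * lebesgue_measure Z)%E.
Proof.
move=> mX mY mZ.
rewrite -[lebesgue3 R _]/((@lebesgue2 R \x lebesgue_measure)%E _).
rewrite product_measure1E//; last exact: measurableX.
by congr (_ * _)%E; exact: product_measure1E.
Qed.

Let lebesgue3_origin : lebesgue3 R origin = 0%E.
Proof.
rewrite originE lebesgue3_box; try exact: measurable_set1.
by rewrite [X in (_ * X)%E]lebesgue_measure_set1 mule0.
Qed.

Let lebesgue3_setD_origin (X : set R3) : measurable X ->
  lebesgue3 R (X `\` origin) = lebesgue3 R X.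
Proof.
move=> mX; rewrite [RHS](measureDI _ mX measurable_origin).
rewrite [X in (_ + X)%E](_ : _ = 0%E) ?adde0//.
by apply: subset_measure0 lebesgue3_origin => //; exact: measurableI.
Qed.

Lemma val_radial (x : R3) : vec3 x != 0 ->
  val (radial x) = (enorm (vec3 x))^-1 *: vec3 x.
Proof.
move=> x0; rewrite val_insubd ifT// dotZl dotZr mulrA -expr2 exprVn.
rewrite sqr_sqrtr ?dot_ge0//.
by rewrite mulVf//; apply: contra x0 => /eqP/dot_eq0 ->.
Qed.

Lemma radial_mx_act A (x : R3) : SO3 A -> vec3 x != 0 ->
  radial (mx_act A x) = rotate A (radial x).
Proof.
move=> sA x0; apply/val_inj; rewrite val_rotate// !val_radial// vec3_mx_act.
  by rewrite /enorm dot_SO3// scalemxAr.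
apply: contra x0 => /eqP Ax0; apply/eqP/dot_eq0.
by rewrite -(dot_SO3 _ _ sA) Ax0 dotE !mxE; ring.
Qed.

(** Off the origin, the cone over the preimage of E is the preimage under [mx_act A] of the cone
    over E, because the unit ball is invariant; so the claim reduces to [preserves_SO3]. *)
Lemma surface_rotate A (E : set (sphere R)) : SO3 A -> measurable E ->
  surface (rotate A @^-1` E) = surface E.
Proof.
move=> sA mE; apply: (congr1 (mule 3%:E)).
have [mA pA] := preserves_SO3 sA.
have mr (F : set (sphere R)) : measurable F ->
    measurable (@radial R @^-1` F `&` @unit_ball3 R).
  move=> mF; apply: measurableI; last exact: measurable_unit_ball3.
  by rewrite -[X in measurable X]setTI; exact: measurable_radial.
have mrE : measurable (rotate A @^-1` E).
  by rewrite -[X in measurable X]setTI; exact: measurable_rotate.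
have mAX : measurable (mx_act A @^-1` (@radial R @^-1` E `&` @unit_ball3 R)).
  by rewrite -[X in measurable X]setTI; apply: mA => //; exact: mr.
rewrite -(pA _ (mr _ mE)).
rewrite -(lebesgue3_setD_origin (mr _ mrE)) -(lebesgue3_setD_origin mAX).
congr (lebesgue3 R _); apply/seteqP; split => x [[rx bx] /eqP x0]; split;
  try exact/eqP.
- split; first by rewrite /preimage /= radial_mx_act.
  by rewrite /preimage /unit_ball3 /= vec3_mx_act /enorm dot_SO3.
- split; first by rewrite /preimage /= -radial_mx_act.
  by move: bx; rewrite /preimage /unit_ball3 /= vec3_mx_act /enorm dot_SO3.
Qed.

Lemma integral_rotate A (f : sphere R -> \bar R) : SO3 A ->
  measurable_fun setT f -> (@surface R).-integrable setT (f \o rotate A) ->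
  (\int[@surface R]_x f (rotate A x) = \int[@surface R]_x f x)%E.
Proof.
move=> sA mf fAi; have mrot := measurable_rotate sA.
have := integral_pushforward mrot mf (D := setT) fAi measurableT.
rewrite preimage_setT => <-.
by apply: eq_measure_integral => E mE _; apply: surface_rotate.
Qed.

Lemma surface_fin : (@surface R setT < +oo)%E.
Proof.
rewrite /surface preimage_setT setTI.
pose J : set T := [set` `[-1, 1 : R]].
have mJ : measurable J by exact: measurable_itv.
have sub : @unit_ball3 R `<=` J `*` J `*` J.
  move=> [[x y] z]; rewrite /unit_ball3 /= /enorm.
  have -> : 1 = Num.sqrt 1 :> R by rewrite sqrtr1.
  rewrite ler_sqrt// dotE !vec3E /= => le1.
  have sq (a b c : R) : a * a + b * b + c * c <= 1 -> -1 <= a <= 1.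
    move=> abc; rewrite -ler_norml -(@expr_le1 _ 2)// real_normK ?num_real//.
    by apply: le_trans abc; rewrite -expr2 -addrA lerDl addr_ge0// -expr2 sqr_ge0.
  by split; [split|]; rewrite /J /= in_itv /=;
    [apply: (sq x y z)|apply: (sq y x z)|apply: (sq z x y)]; lra.
apply: lte_mul_pinfty => //.
have mJJ : measurable (J `*` J) by exact: measurableX.
apply: (@le_lt_trans _ _ (lebesgue3 R (J `*` J `*` J))).
  apply: le_measure => //; rewrite inE; first exact: measurable_unit_ball3.
  exact: measurableX.
by rewrite lebesgue3_box// !lebesgue_measure_itv /= lte_fin ifT ?ltry//
  -?EFinM ?ltry//; lra.
Qed.

Lemma measurable_band (h : R) :
  measurable [set x : sphere R | val x 2%:R 0 ^+ 2 <= h].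
Proof.
rewrite (_ : [set x | _] =
    (fun x : sphere R => sphere_coord 2%:R x ^+ 2 : T) @^-1` [set` `]-oo, h]]).
  rewrite -[X in measurable X]setTI; apply: measurable_funX => //.
  exact: measurable_sphere_coord.
by apply/seteqP; split => x; rewrite /preimage /= in_itv.
Qed.

(* The band contains the radial projection of the box [1/4, 1/2]^2 x [0, h/4]. *)
Lemma surface_band_ge (h : R) : 0 < h -> h <= 1 ->
  ((3 * (h / 64))%:E <= surface [set x : sphere R | (val x 2%:R 0 ^+ 2 <= h ^+ 2)%R])%E.
Proof.
move=> h0 h1; rewrite /surface EFinM lee_pmul2l//.
pose J : set T := [set` `[1 / 4, 1 / 2 : R]].
pose K : set T := [set` `[0, h / 4]].
have mJ : measurable J by exact: measurable_itv.
have mK : measurable K by exact: measurable_itv.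
have mJJ : measurable (J `*` J) by exact: measurableX.
have <- : lebesgue3 R (J `*` J `*` K) = (h / 64)%:E.
  rewrite lebesgue3_box// !lebesgue_measure_itv /= !lte_fin !ifT; last 2 first.
  - by lra.
  - by lra.
  by rewrite -?EFinN -?EFinD -?EFinM; congr EFin; field.
apply: le_measure; rewrite ?inE; first exact: measurableX.
  apply: measurableI; last exact: measurable_unit_ball3.
  rewrite -[X in measurable X]setTI; apply: measurable_radial => //.
  exact: measurable_band.
move=> [[x y] z] /= [[]]; rewrite /J /K /= !in_itv /=.
move=> /andP[x1 x2] /andP[y1 y2] /andP[z1 z2].
(* On the box x^2 + y^2 >= 1 / 8 and z^2 <= h^2 / 16, so the squared height of the projection is at
   most h^2 / 2; and x^2 + y^2 + z^2 <= 1 / 2 + 1 / 16 keeps the box in the ball. *)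
have x16 : 1 / 16 <= x * x by nra.
have x4 : x * x <= 1 / 4 by nra.
have y16 : 1 / 16 <= y * y by nra.
have y4 : y * y <= 1 / 4 by nra.
have z16 : z * z <= h ^+ 2 / 16 by nra.
have h2 : h ^+ 2 <= 1 by nra.
have v0 : vec3 (x, y, z) != 0.
  apply/eqP => /(congr1 (fun v : 'cV[R]_3 => v 0 0)).
  by rewrite vec3E mxE /= => x0; move: x1; rewrite x0; lra.
split.
  rewrite /preimage /= val_radial// mxE vec3E /= exprMn exprVn /enorm.
  rewrite sqr_sqrtr ?dot_ge0// dotE !vec3E /= ler_pdivrMl ?expr2; nra.
rewrite /unit_ball3 /= /enorm -[leRHS]sqrtr1 ler_sqrt// dotE !vec3E /=; nra.
Qed.

End SphereRotation.

(** * Averaging beams about an axis *)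

(** The polynomial X^n - 1 splits and, in characteristic 0, is separable; n distinct n-th roots of
    unity include a primitive one. *)
Lemma prim_root_exists (F : numClosedFieldType) n : (0 < n)%N ->
  exists z : F, n.-primitive_root z.
Proof.
move=> n0; pose p : {poly F} := 'X^n - 1.
have [r Dp] := closed_field_poly_normal p.
rewrite (monicP _) ?monicXnsubC// scale1r in Dp.
have rn1 : all n.-unity_root r by apply/allP => z; rewrite -root_prod_XsubC -Dp.
have sr : (n < (size r).+1)%N.
  by rewrite -(size_prod_XsubC r id) -Dp size_XnsubC.
have ur : uniq r.
  by rewrite -separable_prod_XsubC -Dp separable_Xn_sub_1// pnatr_eq0 -lt0n.
by have [z _ zn] := hasP (has_prim_root n0 rn1 ur sr); exists z.
Qed.

(** Orthogonality of characters: the weight w^k shifts degree i to i + 1, and the only multiple of n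
    + 1 among 1, ..., n + 1 comes from i = n. *)
Lemma sum_prim_root_top (F : fieldType) n (w : F) (g : {poly F}) :
  n.+1.-primitive_root w -> (size g <= n.+1)%N ->
  \sum_(k < n.+1) w ^+ k * g.[w ^+ k] = n.+1%:R * g`_n.
Proof.
move=> wn sg.
transitivity (\sum_(i < n.+1) g`_i * \sum_(k < n.+1) (w ^+ i.+1) ^+ k).
  under eq_bigr => k _ do rewrite (horner_coef_wide _ sg) mulr_sumr.
  rewrite exchange_big; apply: eq_bigr => i _; rewrite mulr_sumr.
  apply: eq_bigr => k _; rewrite mulrCA; congr (_ * _).
  by rewrite -!exprM mulSn -exprD mulnC.
rewrite big_ord_recr /= big1 => [|i _].
  under eq_bigr => k _ do rewrite (prim_expr_order wn) expr1n.
  by rewrite add0r sumr_const card_ord mulrC.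
have wi : w ^+ i.+1 != 1.
  rewrite -(prim_order_dvd wn); apply/negP => /dvdn_leq -/(_ isT).
  by rewrite ltnS leqNgt ltn_ord.
have /eqP : (w ^+ i.+1 - 1) * \sum_(k < n.+1) (w ^+ i.+1) ^+ k = 0.
  by rewrite -subrX1 -exprM mulnC exprM (prim_expr_order wn) expr1n subrr.
by rewrite mulf_eq0 subr_eq0 (negPf wi) /= => /eqP ->; rewrite mulr0.
Qed.

(** Sizes are only bounded above, since the top coefficient may vanish: it does so in the
    application when two poles are antipodal. *)
Lemma coefM_top (F : nzRingType) (p q : {poly F}) m n :
  (size p <= m.+1)%N -> (size q <= n.+1)%N -> (p * q)`_(m + n) = p`_m * q`_n.
Proof.
move=> sp sq; have mmn : (m < (m + n).+1)%N by rewrite ltnS leq_addr.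
rewrite coefM (bigD1 (Ordinal mmn))//= addKn big1 ?addr0// => i im.
have [im'|im'] := leqP i m; last by rewrite nth_default ?mul0r// (leq_trans sp).
rewrite [X in _ * X]nth_default ?mulr0// (leq_trans sq)//.
have {}im : (i < m)%N.
  by rewrite ltn_neqAle im' andbT; apply: contra im => /eqP e; apply/eqP/val_inj.
by rewrite ltn_subRL ltn_add2r.
Qed.

Lemma coefX_top (F : nzRingType) (p : {poly F}) m n : (size p <= m.+1)%N ->
  (p ^+ n)`_(m * n) = p`_m ^+ n.
Proof.
move=> sp; elim: n => [|n IH]; first by rewrite muln0 !expr0 coef1.
rewrite mulnS !exprS coefM_top ?IH//.
apply: leq_trans (size_poly_exp_leq _ _) _; rewrite ltnS leq_mul2r.
by apply/orP; right; case: (size p) sp.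
Qed.

Section Beam.
Variable R : realType.
Local Notation C := R[i].
Implicit Types (A B : 'M[R]_3) (v : 'cV[R]_3) (x y : sphere R) (z w : C).
Import Normc.

Lemma normc_ge0 z : 0 <= normc z.
Proof. by case: z => a b; exact: sqrtr_ge0. Qed.

Lemma normcX z n : normc (z ^+ n) = normc z ^+ n.
Proof. by elim: n => [|n IH]; rewrite ?expr0 ?normc1// !exprS normcM IH. Qed.

Lemma normc_real (a : R) : normc (a%:C)%C = `|a|.
Proof. by rewrite /= expr0n addr0 sqrtr_sqr. Qed.

Lemma normc_sqr z : normc z ^+ 2 = complex.Re z ^+ 2 + complex.Im z ^+ 2.
Proof. by case: z => a b /=; rewrite sqr_sqrtr// addr_ge0 ?sqr_ge0. Qed.

Lemma mulcJ z : z * (z^*)%C = (normc z ^+ 2)%:C%C.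
Proof.
rewrite normc_sqr; case: z => a b /=; simpc.
by apply/eqP; rewrite eq_complex /=; apply/andP; split; apply/eqP; ring.
Qed.

Lemma Re_le_normc z : `|complex.Re z| <= normc z.
Proof.
rewrite -(@ler_pXn2r _ 2) ?nnegrE ?normc_ge0// normc_sqr real_normK ?num_real//.
by rewrite lerDl sqr_ge0.
Qed.

(** * Weights under rotations about the third axis *)

Definition xi v : C := (v 0 0 +i* v 1 0)%C.

(** The weight-one coefficient: xi, x_3 and the conjugate of xi span the linear forms and have
    weights 1, 0, -1 under rotations about the axis, and [xi_mulmx] expands xi after B in them. *)
Definition xi_coef B : C := ((B 0 0 + B 1 1) / 2 +i* ((B 1 0 - B 0 1) / 2))%C.

Lemma xi_mulmx B v :
  xi (B *m v) = xi_coef B * xi v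
    + (B 0 2%:R +i* B 1 2%:R)%C * (v 2%:R 0)%:C%C
    + ((B 0 0 - B 1 1) / 2 +i* ((B 1 0 + B 0 1) / 2))%C * (xi v)^*%C.
Proof.
rewrite /xi /xi_coef !mxE !sum_I3; simpc.
by apply/eqP; rewrite eq_complex /=; apply/andP; split; apply/eqP; field.
Qed.

(** Four times the squared modulus is the squared norm of the upper block plus twice its
    determinant. Unit rows and a unit last column give 1 + b^2 for the norm, b being the corner
    entry, and [SO3_cofactor] gives b for the determinant; the total is (1 + b)^2. *)
Lemma normc_xi_coef B : SO3 B -> normc (xi_coef B) = (1 + B 2%:R 2%:R) / 2.
Proof.
move=> sB; have r00 : _ = 1 := SO3_row sB 0 0; have r11 : _ = 1 := SO3_row sB 1 1.
have c22 : _ = 1 := SO3_row (SO3_tr sB) 2%:R 2%:R; rewrite !mxE in c22.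
have cB := SO3_cofactor sB.
have B22 : -1 <= B 2%:R 2%:R.
  have : `|B 2%:R 2%:R| <= 1.
    rewrite -(@expr_le1 _ 2)// real_normK ?num_real// -c22 expr2 lerDr.
    by rewrite -!expr2 addr_ge0 ?sqr_ge0.
  by rewrite ler_norml => /andP[].
rewrite /xi_coef /=; apply/eqP; rewrite -(@eqrXn2 _ 2) ?sqrtr_ge0//; last by lra.
rewrite sqr_sqrtr ?addr_ge0 ?sqr_ge0//; apply/eqP.
transitivity ((2 * B 2%:R 2%:R +
    (B 0 0 ^+ 2 + B 1 1 ^+ 2 + B 1 0 ^+ 2 + B 0 1 ^+ 2)) / 4).
  by rewrite -cB; field.
have -> : B 0 0 ^+ 2 + B 1 1 ^+ 2 + B 1 0 ^+ 2 + B 0 1 ^+ 2 = 1 + B 2%:R 2%:R ^+ 2.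
  by lra.
by field.
Qed.

Definition axis_rotation (w : C) : 'M[R]_3 :=
  mx3 (complex.Re w) (- complex.Im w) 0 (complex.Im w) (complex.Re w) 0 0 0 1.

Lemma SO3_axis_rotation w : normc w = 1 -> SO3 (axis_rotation w).
Proof. by move=> w1; apply: SO3_mx3_12; rewrite -normc_sqr w1 expr1n. Qed.

Lemma xi_axis_rotation w v : xi (axis_rotation w *m v) = w * xi v.
Proof.
case: w => a b; rewrite /xi /axis_rotation !mxE !sum_I3 !mxE /=; simpc.
by apply/eqP; rewrite eq_complex /=; apply/andP; split; apply/eqP; ring.
Qed.

Lemma axis_rotation2 w v : (axis_rotation w *m v) 2%:R 0 = v 2%:R 0.
Proof. by rewrite /axis_rotation !mxE !sum_I3 !mxE /=; ring. Qed.

(** The integrand of the inner product of two unnormalized beams, once a rotation has put the first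
    in standard position; B is their relative rotation. *)
Definition beam_pair N B v : C := ((xi v)^*%C) ^+ N * xi (B *m v) ^+ N.

(* xi (B (axis_rotation u v)) is a combination of u, 1 and u^-1: the average of
   the N-th powers against u^-N keeps only the coefficient of u^N. *)
Lemma sum_beam_pair N B v (w : C) : (2 * N).+1.-primitive_root w ->
  \sum_(k < (2 * N).+1) beam_pair N B (axis_rotation (w ^+ k) *m v) =
  (2 * N).+1%:R * ((normc (xi v) ^+ (2 * N))%:C%C * xi_coef B ^+ N).
Proof.
move=> wM; set M := (2 * N).+1 in wM *.
have wM1 : w ^+ M = 1 by exact: prim_expr_order.
have nw : normc w = 1.
  apply/eqP; rewrite -(@pexpr_eq1 _ _ M) ?normc_ge0//.
  by rewrite -normcX wM1 normc1.
have wJ : w^*%C = w^-1.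
  have w0 : w != 0 by rewrite (prim_root_eq0 wM).
  by apply: (mulfI w0); rewrite mulcJ nw expr1n mulfV.
pose a := xi_coef B * xi v; pose b := (B 0 2%:R +i* B 1 2%:R)%C * (v 2%:R 0)%:C%C.
pose c := ((B 0 0 - B 1 1) / 2 +i* ((B 1 0 + B 0 1) / 2))%C * (xi v)^*%C.
pose q : {poly C} := a%:P * 'X^2 + b%:P * 'X + c%:P.
have sq : (size q <= 3)%N.
  rewrite /q; apply/leq_sizeP => j j3; rewrite !coefD !coefCM coefX coefXn coefC.
  by case: j j3 => [|[|[|j]]] //= _; rewrite !mulr0 !addr0.
have q2 : q`_2 = a.
  by rewrite /q !coefD !coefCM coefX coefXn coefC /= mulr1 mulr0 !addr0.
(* With u = w^k, q(u) is u^2 times u^-1 (a u + b + c u^-1). The N-th power leaves u^(2N), which the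
   extra factor u completes to u^M = 1. The sum then extracts the coefficient of degree 2N of q^N,
   namely a^N. *)
transitivity (\sum_(k < M) ((xi v)^*%C) ^+ N * (w ^+ k * (q ^+ N).[w ^+ k])).
  apply: eq_bigr => k _; rewrite /beam_pair (xi_mulmx B) xi_axis_rotation.
  rewrite axis_rotation2 horner_exp; set u := w ^+ k.
  have uM : u ^+ M = 1 by rewrite /u exprAC wM1 expr1n.
  have u0 : u != 0 by apply: contra_eq_neq uM => ->; rewrite expr0n eq_sym oner_eq0.
  have uJ : u^*%C = u^-1 by rewrite /u rmorphXn /= wJ exprVn.
  have -> : (u * xi v)^*%C = u^-1 * (xi v)^*%C by rewrite rmorphM /= uJ.
  have -> : q.[u] = u ^+ 2 * (u^-1 * (a * u + b + c * u^-1)).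
    have -> : q.[u] = a * u ^+ 2 + b * u + c by rewrite /q !hornerE.
    by field.
  have -> (y : C) : u * (u ^+ 2 * y) ^+ N = y ^+ N.
    by rewrite exprMn mulrA -exprM -exprS uM mul1r.
  rewrite -!exprMn; congr (_ ^+ _); rewrite /a /b /c; ring.
rewrite -mulr_sumr sum_prim_root_top//; last first.
  apply: leq_trans (size_poly_exp_leq _ _) _; rewrite ltnS leq_mul2r.
  by apply/orP; right; case: (size q) sq.
rewrite coefX_top// q2 /a exprMn mulrCA; congr (_ * _).
rewrite mulrCA [RHS]mulrC; congr (_ * _).
by rewrite -exprMn (mulrC (xi v)^*%C) mulcJ -rmorphXn -exprM.
Qed.

End Beam.

(** * Integration over the sphere *)

Section SphereIntegral.
Variable R : realType.
Local Notation T := (measurableTypeR R).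
Local Notation C := R[i].
Local Notation mu := (@surface R).
Implicit Types (A B : 'M[R]_3) (x y : sphere R).
Import Normc.

(** Since the area is finite these functions are integrable, and they are closed under sums and
    products: membership settles the integrability conditions met below. *)
Definition bounded_measurable (f : sphere R -> R) : Prop :=
  measurable_fun setT (f : sphere R -> T) /\ exists M, forall x, `|f x| <= M.

Lemma bounded_measurable_integrable f : bounded_measurable f ->
  mu.-integrable setT (EFin \o f).
Proof.
move=> [mf [M fM]]; apply: measurable_bounded_integrable => //.
  exact: surface_fin.
by exists M; split; rewrite ?num_real// => y My x _; exact: le_trans (ltW My).
Qed.

Lemma bounded_measurable_cst (r : R) : bounded_measurable (cst r).
Proof. by split; [exact: measurable_cst|exists `|r|]. Qed.

Lemma bounded_measurableD f g : bounded_measurable f -> bounded_measurable g ->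
  bounded_measurable (fun x => f x + g x).
Proof.
move=> [mf [M fM]] [mg [K gK]]; split; first exact: measurable_funD.
by exists (M + K) => x; rewrite (le_trans (ler_normD _ _))// lerD.
Qed.

Lemma bounded_measurableM f g : bounded_measurable f -> bounded_measurable g ->
  bounded_measurable (fun x => f x * g x).
Proof.
move=> [mf [M fM]] [mg [K gK]]; split; first exact: measurable_funM.
by exists (M * K) => x; rewrite normrM ler_pM.
Qed.

Lemma bounded_measurableZ r f : bounded_measurable f ->
  bounded_measurable (fun x => r * f x).
Proof. exact/bounded_measurableM/bounded_measurable_cst. Qed.

Lemma bounded_measurable_coord (i : 'I_3) :
  bounded_measurable (fun x => val x i 0).
Proof.
split; first exact: measurable_sphere_coord.
by exists 1 => x; exact: sphere_coord_le1.
Qed.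

Lemma bounded_measurable_sum (I : Type) (s : seq I) (f : I -> sphere R -> R) :
  (forall i, bounded_measurable (f i)) ->
  bounded_measurable (fun x => \sum_(i <- s) f i x).
Proof.
move=> bf; elim: s => [|i s IH].
  by under eq_fun do rewrite big_nil; exact: bounded_measurable_cst.
by under eq_fun do rewrite big_cons; exact: bounded_measurableD.
Qed.

Lemma Rintegral_sum (I : Type) (s : seq I) (f : I -> sphere R -> R) :
  (forall i, bounded_measurable (f i)) ->
  \int[mu]_x (\sum_(i <- s) f i x) = \sum_(i <- s) \int[mu]_x f i x.
Proof.
move=> bf; elim: s => [|i s IH].
  rewrite big_nil; under eq_Rintegral do rewrite big_nil.
  by rewrite /Rintegral integral0.
rewrite big_cons -IH -RintegralD//.
- by under eq_Rintegral do rewrite big_cons.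
- exact: bounded_measurable_integrable.
- exact/bounded_measurable_integrable/bounded_measurable_sum.
Qed.

Lemma Rintegral_rotate A f : SO3 A -> bounded_measurable f ->
  \int[mu]_x f (rotate A x) = \int[mu]_x f x.
Proof.
move=> sA [mf [M fM]]; congr fine.
apply: (@integral_rotate R A (EFin \o f)) => //; first exact/measurable_EFinP.
apply: (@bounded_measurable_integrable (f \o rotate A)); split.
  by apply: measurableT_comp => //; exact: measurable_rotate.
by exists M => x; exact: fM.
Qed.

Definition cbounded_measurable (f : sphere R -> C) : Prop :=
  bounded_measurable (fun x => complex.Re (f x)) /\
  bounded_measurable (fun x => complex.Im (f x)).

Lemma cbounded_measurableM f g :
  cbounded_measurable f -> cbounded_measurable g ->
  cbounded_measurable (fun x => f x * g x).
Proof.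
move=> [f1 f2] [g1 g2]; split.
  rewrite (_ : (fun x => _) = fun x => complex.Re (f x) * complex.Re (g x) +
      (-1) * (complex.Im (f x) * complex.Im (g x))).
    by apply: bounded_measurableD; [|apply: bounded_measurableZ];
      exact: bounded_measurableM.
  by apply/funext => x; case: (f x) (g x) => [a b] [c d] /=; ring.
rewrite (_ : (fun x => _) = fun x => complex.Re (f x) * complex.Im (g x) +
    complex.Im (f x) * complex.Re (g x)).
  by apply: bounded_measurableD; exact: bounded_measurableM.
by apply/funext => x; case: (f x) (g x) => [a b] [c d] /=; ring.
Qed.

Lemma cbounded_measurable_cst (c : C) : cbounded_measurable (cst c).
Proof. by split; exact: bounded_measurable_cst. Qed.

Lemma cbounded_measurableX f n : cbounded_measurable f ->
  cbounded_measurable (fun x => f x ^+ n).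
Proof.
move=> bf; elim: n => [|n IH].
  by under eq_fun do rewrite expr0; exact: cbounded_measurable_cst.
by under eq_fun do rewrite exprS; exact: cbounded_measurableM.
Qed.

Lemma cbounded_measurable_conj f : cbounded_measurable f ->
  cbounded_measurable (fun x => (f x)^*%C).
Proof.
move=> [f1 f2]; split.
  rewrite (_ : (fun x => _) = fun x => complex.Re (f x))//.
  by apply/funext => x; case: (f x).
rewrite (_ : (fun x => _) = fun x => (-1) * complex.Im (f x)).
  exact: bounded_measurableZ.
by apply/funext => x; case: (f x) => a b /=; rewrite mulN1r.
Qed.

Lemma cbounded_measurable_sum (I : Type) (s : seq I) (f : I -> sphere R -> C) :
  (forall i, cbounded_measurable (f i)) ->
  cbounded_measurable (fun x => \sum_(i <- s) f i x).
Proof.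
move=> bf; elim: s => [|i s IH].
  by under eq_fun do rewrite big_nil; exact: cbounded_measurable_cst.
have [IH1 IH2] := IH; have [f1 f2] := bf i.
under eq_fun do rewrite big_cons; split.
  rewrite (_ : (fun x => _) = fun x => complex.Re (f i x) +
    complex.Re (\sum_(j <- s) f j x)); first exact: bounded_measurableD.
  by apply/funext => x; case: (f i x) (\sum_(j <- s) f j x) => [a b] [c d].
rewrite (_ : (fun x => _) = fun x => complex.Im (f i x) +
  complex.Im (\sum_(j <- s) f j x)); first exact: bounded_measurableD.
by apply/funext => x; case: (f i x) (\sum_(j <- s) f j x) => [a b] [c d].
Qed.

Lemma cbounded_measurable_xi B : cbounded_measurable (fun x => xi (B *m val x)).
Proof.
have bm i : bounded_measurable (fun x => (B *m val x) i 0).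
  under eq_fun do rewrite mxE.
  apply: bounded_measurable_sum => j; apply: bounded_measurableZ.
  exact: bounded_measurable_coord.
by split; exact: bm.
Qed.

Lemma bounded_measurable_normc2 f : cbounded_measurable f ->
  bounded_measurable (fun x => normc (f x) ^+ 2).
Proof.
move=> [f1 f2]; under eq_fun do rewrite normc_sqr !expr2.
by apply: bounded_measurableD; exact: bounded_measurableM.
Qed.

Lemma bounded_measurable_xi_exp N :
  bounded_measurable (fun x => normc (xi (val x)) ^+ (2 * N)).
Proof.
have := bounded_measurable_normc2 (cbounded_measurableX N (cbounded_measurable_xi 1)).
by under eq_fun do rewrite normcX mul1mx -exprM mulnC.
Qed.

(** * Norms and inner products of beams *)

Lemma Lnorm2E f : cbounded_measurable f ->
  sphere_Lnorm 2%:E f = (Num.sqrt (\int[mu]_x normc (f x) ^+ 2))%:E.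
Proof.
move=> bf; have bi := bounded_measurable_integrable (bounded_measurable_normc2 bf).
rewrite /sphere_Lnorm unlock /Lnorm.
under eq_integral => x _.
  rewrite abse_EFin ger0_norm ?normc_ge0// poweR_EFin powR_mulrn ?normc_ge0//; over.
rewrite -[X in (X `^ _)%E]fineK ?poweR_EFin; last exact: integrable_fin_num.
by rewrite powR12_sqrt//; apply: Rintegral_ge0 => x _; exact: sqr_ge0.
Qed.

Lemma Lnormy_le f (K : R) : 0 <= K -> (forall x, normc (f x) <= K) ->
  (sphere_Lnorm +oo f <= K%:E)%E.
Proof.
move=> K0 fK; rewrite /sphere_Lnorm unlock /Lnorm; case: ifP => _ //.
apply/ess_supP; apply/nearW => x.
by rewrite /= lee_fin ger0_norm ?normc_ge0.
Qed.

Definition beam_mass N : R := \int[mu]_x normc (xi (val x)) ^+ (2 * N).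

(** By invariance each of the M rotated integrands has the same integral, so M times the integral is
    the integral of their sum, which [sum_beam_pair] evaluates pointwise. *)
Lemma integral_beam_pair N B : SO3 B ->
  \int[mu]_x complex.Re (beam_pair N B (val x)) =
  beam_mass N * complex.Re (xi_coef B ^+ N).
Proof.
move=> sB; have [w wM] := prim_root_exists (complex R) (ltn0Sn (2 * N)).
set M := (2 * N).+1 in wM.
have bp : bounded_measurable (fun x => complex.Re (beam_pair N B (val x))).
  suff: cbounded_measurable (fun x => beam_pair N B (val x)) by case.
  apply: cbounded_measurableM; apply: cbounded_measurableX; last first.
    exact: cbounded_measurable_xi.
  apply: cbounded_measurable_conj.
  by have := cbounded_measurable_xi 1; under eq_fun do rewrite mul1mx.
have M0 : M%:R != 0 :> R by rewrite pnatr_eq0.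
have w1 : normc w = 1.
  apply/eqP; rewrite -(@pexpr_eq1 _ _ M) ?normc_ge0//.
  by rewrite -normcX prim_expr_order ?normc1.
apply: (mulfI M0).
transitivity (\int[mu]_x \sum_(k < M)
    complex.Re (beam_pair N B (axis_rotation (w ^+ k) *m val x))).
  have sk (k : 'I_M) : SO3 (axis_rotation (w ^+ k)).
    by apply: SO3_axis_rotation; rewrite normcX w1 expr1n.
  rewrite Rintegral_sum => [|k]; last first.
    have [mb [K bK]] := bp; split; last first.
      by exists K => x; rewrite -val_rotate.
    rewrite (_ : (fun x => _) =
      (fun x => complex.Re (beam_pair N B (val x))) \o rotate (axis_rotation (w ^+ k))).
      by apply: measurableT_comp => //; exact: measurable_rotate.
    by apply/funext => x /=; rewrite val_rotate.
  rewrite mulr_natl -[X in _ *+ X]card_ord -sumr_const; apply: eq_bigr => k _.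
  rewrite -(Rintegral_rotate (sk k) bp).
  by apply: eq_Rintegral => x _; rewrite val_rotate.
rewrite /beam_mass.
transitivity (\int[mu]_x (M%:R * complex.Re (xi_coef B ^+ N) *
    normc (xi (val x)) ^+ (2 * N))).
  apply: eq_Rintegral => x _.
  have := congr1 (@complex.Re R) (sum_beam_pair B (val x) wM).
  rewrite raddf_sum => ->.
  have ReZ (r : R) (z : C) : complex.Re (r%:C%C * z) = r * complex.Re z.
    by case: z => a b /=; ring.
  rewrite (_ : M%:R = (M%:R : R)%:C%C); last by rewrite rmorph_nat.
  by rewrite !ReZ; ring.
rewrite RintegralZl//; first by rewrite -mulrA [X in _ * X]mulrC.
exact/bounded_measurable_integrable/bounded_measurable_xi_exp.
Qed.

(** On the band where x_3^2 <= h^2 = 1 / (2N), Bernoulli's inequality gives (1 - x_3^2)^N >= 1 - N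
    h^2 = 1 / 2, and the area of the band is at least 3 h / 64. *)
Lemma beam_mass_ge N : (0 < N)%N ->
  3 / 128 / Num.sqrt (2 * N%:R) <= beam_mass N.
Proof.
move=> N0; pose h : R := (Num.sqrt (2 * N%:R))^-1.
have N1 : 1 <= N%:R :> R by rewrite ler1n.
have s1 : 1 <= Num.sqrt (2 * N%:R) :> R.
  by rewrite -[leLHS]sqrtr1 ler_sqrt; lra.
have h0 : 0 < h by rewrite invr_gt0; lra.
have h1 : h <= 1 by rewrite invf_le1//; lra.
have h2 : h ^+ 2 * (2 * N%:R) = 1.
  by rewrite exprVn sqr_sqrtr ?mulVf//; lra.
pose S := [set x : sphere R | (val x 2%:R 0 ^+ 2 <= h ^+ 2)%R].
have mS : measurable S by exact: measurable_band.
have xi2 x : normc (xi (val x)) ^+ 2 = 1 - val x 2%:R 0 ^+ 2.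
  by rewrite normc_sqr; have := dot_sphere x; rewrite dotE /=; lra.
have bm := bounded_measurable_xi_exp N.
have half x : S x -> 1 / 2 <= normc (xi (val x)) ^+ (2 * N).
  rewrite /S /= exprM xi2; set t := val x 2%:R 0 ^+ 2 => th.
  have t0 : 0 <= t by exact: sqr_ge0.
  have h21 : h ^+ 2 <= 1 by rewrite expr_le1//; exact: ltW.
  have bern n : 1 - n%:R * t <= (1 - t) ^+ n.
    elim: n => [|n IH]; first by rewrite mul0r subr0 expr0.
    have t1 : 0 <= 1 - t by lra.
    rewrite exprS; apply: le_trans (ler_wpM2l t1 IH).
    have : 0 <= n%:R * (t * t) by rewrite mulr_ge0 ?ler0n// mulr_ge0.
    by rewrite -addn1 natrD; lra.
  apply: le_trans (bern N).
  have : N%:R * t <= N%:R * h ^+ 2 by rewrite ler_wpM2l.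
  by lra.
have : ((3 / 128 * h)%:E <= \int[mu]_x (normc (xi (val x)) ^+ (2 * N))%:E)%E.
  apply: (@le_trans _ _ (\int[mu]_(x in S) (1 / 2)%:E)%E).
    rewrite integral_cst//; apply: le_trans (lee_wpmul2l _ (surface_band_ge h0 h1)).
      by rewrite -EFinM lee_fin; lra.
    by rewrite lee_fin; lra.
  apply: (@le_trans _ _ (\int[mu]_(x in S) (normc (xi (val x)) ^+ (2 * N))%:E)%E).
    apply: ge0_le_integral => //.
    by apply: measurable_funTS; apply/measurable_EFinP; case: bm.
  apply: ge0_subset_integral => //.
    by apply/measurable_EFinP; case: bm.
  by move=> x _; rewrite lee_fin exprn_ge0// normc_ge0.
by rewrite /beam_mass /Rintegral -[X in (_ <= X)%E -> _]fineK ?lee_fin//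
  integrable_fin_num//; exact: bounded_measurable_integrable.
Qed.

(** Rotating the variable by A brings the first beam to standard position and leaves the relative
    rotation in the second. *)
Lemma integral_beam_product N A B : SO3 A -> SO3 B ->
  \int[mu]_x complex.Re (((xi (A^T *m val x))^*%C) ^+ N * xi (B^T *m val x) ^+ N) =
  beam_mass N * complex.Re (xi_coef (B^T *m A) ^+ N).
Proof.
move=> sA sB; rewrite -integral_beam_pair; last exact/SO3_mul/sA/SO3_tr.
have : cbounded_measurable (fun x =>
    ((xi (A^T *m val x))^*%C) ^+ N * xi (B^T *m val x) ^+ N).
  apply: cbounded_measurableM; apply: cbounded_measurableX; last first.
    exact: cbounded_measurable_xi.
  exact/cbounded_measurable_conj/cbounded_measurable_xi.
move=> [bm _]; rewrite -(Rintegral_rotate sA bm).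
apply: eq_Rintegral => x _; rewrite (val_rotate x sA).
have -> : A^T *m (A *m val x) = val x by rewrite mulmxA SO3_tr_mul// mul1mx.
by rewrite [B^T *m _]mulmxA.
Qed.

(** The squared modulus of the sum is a real double sum of products of beams with conjugates of
    beams, so the real parts of the inner products suffice. *)
Lemma integral_normc2_beams N m (a : R) (A : 'I_m -> 'M[R]_3) :
  (forall j, SO3 (A j)) ->
  \int[mu]_x normc (\sum_(j < m) a%:C%C * xi ((A j)^T *m val x) ^+ N) ^+ 2 =
  a ^+ 2 * beam_mass N *
    \sum_(j < m) \sum_(k < m) complex.Re (xi_coef ((A k)^T *m A j) ^+ N).
Proof.
move=> sA.
pose g j k x := complex.Re
  (((xi ((A j)^T *m val x))^*%C) ^+ N * xi ((A k)^T *m val x) ^+ N).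
have bg j k : bounded_measurable (g j k).
  suff [] : cbounded_measurable (fun x =>
      ((xi ((A j)^T *m val x))^*%C) ^+ N * xi ((A k)^T *m val x) ^+ N) by [].
  apply: cbounded_measurableM; apply: cbounded_measurableX; last first.
    exact: cbounded_measurable_xi.
  exact/cbounded_measurable_conj/cbounded_measurable_xi.
have bs : bounded_measurable (fun x => \sum_(j < m) \sum_(k < m) g j k x).
  by do 2!apply: bounded_measurable_sum => ?.
transitivity (\int[mu]_x (a ^+ 2 * \sum_(j < m) \sum_(k < m) g j k x)).
  apply: eq_Rintegral => x _.
  rewrite -[LHS]/(complex.Re ((_ : R)%:C%C)) -mulcJ mulrC.
  have aJ : conjc a%:C%C * a%:C%C = (a ^+ 2)%:C%C by rewrite conjc_real -rmorphM.
  rewrite -mulr_sumr rmorphM mulrACA aJ rmorph_sum big_distrlr.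
  have ReZ (r : R) (z : C) : complex.Re (r%:C%C * z) = r * complex.Re z.
    by case: z => ? ? /=; ring.
  rewrite ReZ; congr (_ * _); rewrite raddf_sum; apply: eq_bigr => j _.
  rewrite raddf_sum; apply: eq_bigr => k _.
  by rewrite /g rmorphXn.
rewrite RintegralZl//; last exact: bounded_measurable_integrable.
rewrite -mulrA; congr (_ * _); rewrite Rintegral_sum; last first.
  by move=> j; apply: bounded_measurable_sum.
rewrite mulr_sumr; apply: eq_bigr => j _.
rewrite Rintegral_sum// mulr_sumr; apply: eq_bigr => k _.
exact: integral_beam_product.
Qed.

End SphereIntegral.

(** * Counting poles near great circles *)

Section Trigonometry.
Variable R : realType.
Implicit Types (x : R).

Lemma sin_MVT x : 0 < x -> exists2 c, 0 < c < x & sin x = cos c * x.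
Proof.
move=> x0; have [|c] := @MVT R sin cos 0 x x0 (fun y _ => is_derive_sin y).
  by apply: continuous_subspaceT; exact: continuous_sin.
by rewrite in_itv /= sin0 !subr0 => c0x ->; exists c.
Qed.

Lemma sin_le x : 0 <= x -> sin x <= x.
Proof.
rewrite le_eqVlt => /predU1P[<-|/[dup] x0 /sin_MVT[c _ ->]]; first by rewrite sin0.
by rewrite ler_piMl// ?cos_le1// ltW.
Qed.

Lemma sin_ge x : 0 <= x <= 1 -> cos 1 * x <= sin x.
Proof.
move=> /andP[]; rewrite le_eqVlt => /predU1P[<-|x0 x1].
  by rewrite sin0 mulr0.
have [c /andP[c0 cx] ->] := sin_MVT x0.
have p2 := pi_ge2 R.
by rewrite ler_pM2r// leNgt ltr_cos ?in_itv /=; lra.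
Qed.

Lemma cos1_ge_half : 1 / 2 <= cos (1 : R).
Proof.
(* cos 1 = 1 - 2 sin(1/2)^2, and sin(1/2) <= 1/2. *)
rewrite [X in cos X](_ : 1 = 2^-1 *+ 2); last by rewrite -mulr_natr; field.
rewrite cos_mulr2n cos2sin2.
have s1 : sin (2^-1 : R) <= 2^-1 by apply: sin_le; lra.
have s0 : 0 <= sin (2^-1 : R).
  by apply: sin_ge0_pi; have := pi_ge2 R; lra.
have : sin (2^-1 : R) ^+ 2 <= 2^-1 ^+ 2 by rewrite ler_pXn2r// nnegrE; lra.
by lra.
Qed.

(** The identity cos x = 1 - 2 sin(x/2)^2 turns the linear lower bound for the sine into a quadratic
    upper bound for the cosine. *)
Lemma cos_le x : 0 <= x <= 1 -> cos x <= 1 - cos 1 ^+ 2 / 2 * x ^+ 2.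
Proof.
move=> /andP[x0 x1].
rewrite [X in cos X](_ : _ = x / 2 *+ 2); last by rewrite -mulr_natr; field.
rewrite cos_mulr2n cos2sin2.
have s : cos 1 * (x / 2) <= sin (x / 2) by apply: sin_ge; lra.
have c0 := cos1_gt0 R.
have : (cos 1 * (x / 2)) ^+ 2 <= sin (x / 2) ^+ 2.
  rewrite ler_pXn2r// nnegrE; last apply: le_trans s; rewrite mulr_ge0//; lra.
by rewrite exprMn; lra.
Qed.

End Trigonometry.

Section Counting.
Variable R : realType.
Implicit Types (x y v p : sphere R).

(** Cauchy-Schwarz: the component of x orthogonal to y has squared length 1 - <x, y>^2. *)
Lemma dot_sphere_le1 x y : -1 <= dot (val x) (val y) <= 1.
Proof.
rewrite -ler_norml -(@expr_le1 _ 2)// real_normK ?num_real//.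
have := dot_ge0 (val x - dot (val x) (val y) *: val y).
rewrite -scaleN1r scalerA !dotDl !dotZl ![dot _ (_ + _)]dotC !dotDl !dotZl.
by rewrite !dot_sphere [dot (val y) _]dotC; lra.
Qed.

Lemma geodist_dot_le x y (r : R) : 0 <= r <= 1 -> r <= geodist x y ->
  dot (val x) (val y) <= 1 - cos 1 ^+ 2 / 2 * r ^+ 2.
Proof.
move=> r01 rxy; apply: le_trans (cos_le r01).
have d1 := dot_sphere_le1 x y; have p2 := pi_ge2 R.
rewrite -[leLHS](acosK (x := dot (val x) (val y))) ?in_itv//.
rewrite -/(geodist x y) leNgt ltr_cos ?in_itv /= -?leNgt//.
  by have := acos_ge0 d1; have := acos_lepi d1; rewrite /geodist => -> ->.
by move: r01; lra.
Qed.

Definition equator v : set (sphere R) := [set x | dot (val v) (val x) = 0].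

(** The nearest point of the circle is the normalized projection y of p along v, with <y, p> =
    sqrt(1 - s^2). The distance, the arcsine of |s|, is at most 2 t because t <= sin(2 t), which
    follows from cos 1 >= 1 / 2. *)
Lemma neighborhood_equator v p (t : R) : 0 <= t <= 1 / 2 ->
  `|dot (val v) (val p)| <= t -> p \in neighborhood (2 * t) (equator v).
Proof.
move=> /andP[t0 t12] vpt; set s := dot (val v) (val p) in vpt.
have s2t : s ^+ 2 <= t ^+ 2.
  by rewrite -[s ^+ 2]real_normK ?num_real// ler_pXn2r ?nnegrE.
have t24 : t ^+ 2 <= 1 / 4 by rewrite expr2; nra.
have s1 : 0 < 1 - s ^+ 2 by lra.
pose w := val p - s *: val v.
have wp : dot w (val p) = 1 - s ^+ 2.
  by rewrite /w -scaleN1r scalerA dotDl dotZl dot_sphere -/s; ring.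
have vw : dot (val v) w = 0.
  by rewrite dotC /w -scaleN1r scalerA dotDl dotZl dot_sphere dotC -/s; ring.
have ww : dot w w = 1 - s ^+ 2.
  by rewrite {2}/w -scaleN1r scalerA dotC dotDl dotZl vw mulr0 addr0 dotC.
pose r := Num.sqrt (1 - s ^+ 2).
have r0 : 0 < r by rewrite sqrtr_gt0.
have r2 : r ^+ 2 = 1 - s ^+ 2 by rewrite sqr_sqrtr// ltW.
have uy : dot (r^-1 *: w) (r^-1 *: w) == 1.
  by rewrite dotZl dotZr ww -r2; apply/eqP; field; rewrite gt_eqF.
pose y : sphere R :=
  exist (fun u : 'cV[R]_3 => dot u u == 1) _ uy.
have py : dot (val y) (val p) = r.
  by rewrite /= dotZl wp -r2; field; rewrite gt_eqF.
rewrite inE /neighborhood /=; apply: (@le_trans _ _ (geodist y p)%:E).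
  by apply: ereal_inf_lbound; exists y => //; rewrite /equator /= dotZr vw mulr0.
rewrite lee_fin /geodist py.
have r1 : -1 <= r <= 1 by rewrite -py dot_sphere_le1.
have p2 := pi_ge2 R.
have st : t <= sin (2 * t).
  apply: le_trans (sin_ge _); last by lra.
  by have := cos1_ge_half R; nra.
rewrite leNgt -ltr_cos ?in_itv /= ?acos_ge0 ?acos_lepi//; last by lra.
rewrite acosK ?in_itv// -leNgt.
have c0 : 0 <= cos (2 * t) by apply: cos_ge0_pihalf; have := pihalf_ge1 R; lra.
rewrite -(@ler_pXn2r _ 2) ?nnegrE ?(ltW r0)// r2 cos2sin2.
have : t ^+ 2 <= sin (2 * t) ^+ 2 by rewrite ler_pXn2r ?nnegrE//; lra.
by lra.
Qed.

(* If <x, p> = t and |p_i| >= 1/2 then x + s e_i is orthogonal to p for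
   s = - t / p_i; the index l counts the possible values of s rounded to a
   multiple of 1 / (4 m), when |t| <= k / m and hence |s| <= 2 k / m. *)
Definition cover_vec m k x (i : 'I_3) (l : nat) : 'cV[R]_3 :=
  val x + ((l%:R - 8 * k%:R) / (4 * m%:R)) *: delta_mx i 0.

Definition cover_pole m k x i l : sphere R :=
  insubd (north_pole R) ((enorm (cover_vec m k x i l))^-1 *: cover_vec m k x i l).

Lemma dot_delta (u : 'cV[R]_3) i : dot (delta_mx i 0) u = u i 0.
Proof.
rewrite dotE !mxE !eqxx !andbT; move: i.
by apply: forall_I3; rewrite /= ?mul1r !mul0r ?addr0 ?add0r.
Qed.

Lemma exists_big_coord p : exists i, 1 / 2 <= `|val p i 0|.
Proof.
have [H|] := pselect (exists i, 1 / 2 <= `|val p i 0|); first by [].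
move=> /forallNP H; have {}H i : val p i 0 ^+ 2 <= 1 / 4.
  have /negP := H i; rewrite -ltNge => Hi.
  rewrite -[val p i 0 ^+ 2]real_normK ?num_real//.
  by have := normr_ge0 (val p i 0); nra.
have := dot_sphere p; rewrite dotE -!expr2.
by move: (H 0) (H 1) (H 2%:R); lra.
Qed.

Lemma cover_band m k x p : (0 < m)%N -> 8 * k%:R <= m%:R :> R ->
  `|dot (val x) (val p)| <= k%:R / m%:R ->
  exists i, exists2 l, (l < 16 * k + 1)%N &
    p \in neighborhood (m%:R^-1) (equator (cover_pole m k x i l)).
Proof.
move=> m0 km xp; have {}m0 : 0 < m%:R :> R by rewrite ltr0n.
have [i pi] := exists_big_coord p; exists i.
set t := dot (val x) (val p) in xp; set q := val p i 0 in pi.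
have q0 : q != 0 by apply: contraTneq pi => ->; rewrite normr0; lra.
have q1 : `|q| <= 1 by exact: sphere_coord_le1.
pose s0 := - t / q.
have s0q : s0 * q = - t by rewrite mulfVK.
have s0m : `|s0 * m%:R| <= 2 * k%:R.
  have tm : `|t| * m%:R <= k%:R by rewrite -ler_pdivlMr.
  have : `|s0| * m%:R * (1 / 2) <= `|s0| * m%:R * `|q|.
    by rewrite ler_wpM2l// mulr_ge0// ltW.
  rewrite [X in _ <= X]mulrAC -normrM s0q normrN.
  by rewrite [in X in _ -> X]normrM (gtr0_norm m0); lra.
move: (s0m); rewrite ler_norml => /andP[s0m1 s0m2].
(* The shift by 8 k makes the quantity to be rounded down nonnegative; the bound 16 k then leaves 16
   k + 1 values of the index. *)
pose z := 4 * (s0 * m%:R) + 8 * k%:R.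
have z0 : 0 <= z by rewrite /z; lra.
have zk : z <= 16 * k%:R by rewrite /z; lra.
have /andP[lz zl] := truncn_itv z0.
exists (Num.truncn z).
  by rewrite -(ltr_nat R) natrD natrM; lra.
set l := Num.truncn z in lz zl *.
have l0 : 0 <= l%:R :> R by exact: ler0n.
rewrite -natr1 in zl.
pose s : R := (l%:R - 8 * k%:R) / (4 * m%:R).
have sm : s * (4 * m%:R) = l%:R - 8 * k%:R by rewrite mulfVK// gt_eqF//; lra.
have ss0 : `|s - s0| * (4 * m%:R) <= 1.
  rewrite -[X in _ * X]gtr0_norm; last by lra.
  by rewrite -normrM mulrBl sm ler_norml; move: lz zl; rewrite /z; lra.
(* This is where 8 k <= m is used: a small s keeps the perturbed vector away from 0, with norm at
   least 1 / 2. *)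
have s14 : `|s| <= 1 / 4.
  have : `|s| * (4 * m%:R) <= 8 * k%:R.
    rewrite -[X in _ * X]gtr0_norm; last by lra.
    by rewrite -normrM sm ler_norml; lra.
  by move=> h; rewrite -(@ler_pM2r _ (4 * m%:R)); lra.
have xi1 := sphere_coord_le1 x i.
set cv := cover_vec m k x i l.
have cvE : cv = val x + s *: delta_mx i 0 by [].
have cvcv : dot cv cv = 1 + 2 * (s * val x i 0) + s ^+ 2.
  rewrite cvE dotDl dotZl dot_delta [dot (val x) _]dotC dotDl dotZl dot_delta.
  by rewrite dot_sphere !mxE !eqxx /=; ring.
have cv12 : 1 / 4 <= dot cv cv.
  have : `|s * val x i 0| <= 1 / 4.
    by rewrite normrM; apply: le_trans s14; rewrite ler_piMr.
  rewrite ler_norml => /andP[h1 h2]; rewrite cvcv.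
  by have := sqr_ge0 s; lra.
pose r := enorm cv.
have r2 : r ^+ 2 = dot cv cv by rewrite sqr_sqrtr// dot_ge0.
have r12 : 1 / 2 <= r.
  by rewrite -(@ler_pXn2r _ 2) ?nnegrE ?sqrtr_ge0 ?r2 //; lra.
have r0 : r != 0 by rewrite gt_eqF//; lra.
have vpole : val (cover_pole m k x i l) = r^-1 *: cv.
  rewrite val_insubd ifT// dotZl dotZr -/cv -r2 -/r.
  by apply/eqP; field.
(* The pole has inner product (s - s0) q / r with p; since |s - s0| <= 1 / (4 m), |q| <= 1 and r >=
   1 / 2, it is at most 1 / (2 m) in modulus. *)
rewrite (_ : m%:R^-1 = 2 * (1 / (2 * m%:R))); last by field; rewrite gt_eqF.
apply: neighborhood_equator.
  have m1 : 1 <= m%:R :> R by rewrite ler1n -(ltr0n R).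
  have m20 : 0 < 2 * m%:R :> R by rewrite mulr_gt0.
  by rewrite ltW ?divr_gt0// ler_pdivrMr//; lra.
rewrite vpole dotZl cvE dotDl dotZl dot_delta -/t -/q.
have -> : t + s * q = (s - s0) * q by rewrite mulrBl s0q; ring.
rewrite normrM normfV (gtr0_norm (_ : 0 < r)); last by lra.
rewrite ler_pdivrMl; last by lra.
rewrite mulrCA mul1r ler_pdivlMr; last by lra.
have : `|(s - s0) * q| <= `|s - s0| by rewrite normrM ler_piMr.
move=> h; have : `|(s - s0) * q| * (4 * m%:R) <= 1.
  by apply: le_trans ss0; rewrite ler_wpM2r//; lra.
by lra.
Qed.

Lemma card_band_le m (P : 'I_m -> sphere R) (L : R) x k : 1 <= L ->
  (forall G : set (sphere R), great_circle G ->
    #|[pred j | P j \in neighborhood (m%:R^-1) G]|%:R <= L) ->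
  #|[pred j | `|dot (val x) (val (P j))| <= k.+1%:R / m%:R]|%:R <= 51 * k.+1%:R * L.
Proof.
move=> L1 HL; set S := [pred j | _].
have k1 : 1 <= k.+1%:R :> R by rewrite ler1n.
have [km|mk] := leqP (8 * k.+1) m; last first.
  have : #|S|%:R <= m%:R :> R by rewrite ler_nat -[leqRHS]card_ord max_card.
  have : m%:R <= 8 * k.+1%:R :> R by rewrite -natrM ler_nat ltnW.
  by nra.
have m0 : (0 < m)%N by apply: leq_trans km.
pose S' i l := [pred j | P j \in
  neighborhood (m%:R^-1) (equator (cover_pole m k.+1 x i l))].
have SS' : (#|S| <= \sum_(i < 3) \sum_(l < 16 * k.+1 + 1) #|S' i l|)%N.
  under eq_bigr => i _.
    under eq_bigr => l _ do rewrite -sum1_card big_mkcond /=.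
    rewrite exchange_big /=; over.
  rewrite exchange_big -sum1_card big_mkcond /=; apply: leq_sum => j _.
  case: ifPn => // jS.
  have km' : 8 * k.+1%:R <= m%:R :> R by rewrite -natrM ler_nat.
  have [i [l lk jil]] := cover_band m0 km' jS.
  have le_sum (I : finType) (F : I -> nat) i' : (F i' <= \sum_i F i)%N.
    by rewrite (bigD1 i')//= leq_addr.
  apply: leq_trans (le_sum _ _ i); apply: leq_trans (le_sum _ _ (Ordinal lk)).
  by rewrite ifT.
have := SS'; rewrite -(ler_nat R) => /le_trans; apply.
rewrite natr_sum; under eq_bigr do rewrite natr_sum.
apply: (@le_trans _ _ (\sum_(i < 3) \sum_(l < 16 * k.+1 + 1) L)).
  do 2?apply: ler_sum => ? _; apply: HL.
  by eexists.
rewrite !sumr_const !card_ord -mulrnA -[leLHS]mulr_natl !(natrM, natrD).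
by rewrite ler_wpM2r//; lra.
Qed.

(** * Summation of the decay over bands *)

Lemma sum_inv_triangular n :
  \sum_(k < n) ((k.+1%:R * k.+2%:R)^-1 : R) = 1 - n.+1%:R^-1.
Proof.
elim: n => [|n IH]; first by rewrite big_ord0 invr1 subrr.
rewrite big_ord_recr /= IH -[n.+2%:R]natr1.
have : n.+1%:R != 0 :> R by rewrite pnatr_eq0.
have : n.+1%:R + 1 != 0 :> R by rewrite natr1 pnatr_eq0.
by move: (n.+1%:R) => a a1 a0; field; rewrite ?a0 ?a1.
Qed.

(* Dominates exp (- k ^ 2 / 2), by (1 + y) ^ 2 <= exp (2 y) at y = k ^ 2 / 4. *)
Definition profile (k : nat) : R := 16 / (4 + k%:R ^+ 2) ^+ 2.

(** The factor k + 1 is the growth of the band count; the right-hand side telescopes when summed. *)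
Lemma profile_le k : k.+1%:R * profile k <= 32 / (k.+1%:R * k.+2%:R).
Proof.
rewrite /profile -[k.+2%:R]natr1 -[k.+1%:R]natr1.
have : 0 <= k%:R :> R by exact: ler0n.
move: (k%:R) => a a0.
have h : 0 < 4 + a ^+ 2 by have := sqr_ge0 a; lra.
rewrite mulrA ler_pdivrMr ?exprn_gt0// mulrAC ler_pdivlMr; last by nra.
have h1 : (a + 1) ^+ 2 <= 2 * (4 + a ^+ 2) by nra.
have h2 : a + 1 + 1 <= 4 + a ^+ 2 by nra.
have : (a + 1) ^+ 2 * (a + 1 + 1) <= 2 * (4 + a ^+ 2) * (4 + a ^+ 2).
  by apply: ler_pM => //; [exact: sqr_ge0|lra].
by nra.
Qed.

(** Poles are grouped by the integer part k of m |<x, p_j>|; group k lies in the band of half-width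
    (k + 1) / m. The constant is 51 from the count times 32 from [profile_le], and the telescoping
    sum is below 1. *)
Lemma sum_profile_le m (P : 'I_m -> sphere R) (L : R) x : (0 < m)%N -> 1 <= L ->
  (forall G : set (sphere R), great_circle G ->
    #|[pred j | P j \in neighborhood (m%:R^-1) G]|%:R <= L) ->
  \sum_(j < m) profile (Num.truncn (m%:R * `|dot (val x) (val (P j))|)) <= 1632 * L.
Proof.
move=> m0 L1 HL; have m0' : 0 < m%:R :> R by rewrite ltr0n.
pose t j := m%:R * `|dot (val x) (val (P j))|.
have t0 j : 0 <= t j by rewrite mulr_ge0// ltW.
have tm j : (Num.truncn (t j) < m.+1)%N.
  rewrite ltnS -(ler_nat R); have /andP[+ _] := truncn_itv (t0 j).
  move/le_trans; apply; rewrite ler_piMr ?(ltW m0')//.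
  by rewrite ler_norml dot_sphere_le1.
apply: (@le_trans _ _
    (\sum_(k < m.+1) #|[pred j | Num.truncn (t j) == k]|%:R * profile k)).
  rewrite le_eqVlt; apply/orP; left; apply/eqP.
  rewrite (partition_big (fun j => Ordinal (tm j)) predT)//=.
  apply: eq_bigr => k _; rewrite mulr_natl -sumr_const.
  rewrite [LHS](eq_bigr (fun=> profile k)) => [|j /eqP <-//].
  by apply: eq_bigl => j; rewrite inE.
apply: (@le_trans _ _ (\sum_(k < m.+1) 1632 * L * (k.+1%:R * k.+2%:R)^-1)).
  apply: ler_sum => k _.
  have p0 : 0 <= profile k by rewrite divr_ge0// exprn_ge0// addr_ge0 ?sqr_ge0.
  apply: (@le_trans _ _ (51 * k.+1%:R * L * profile k)).
    rewrite ler_wpM2r//; apply: le_trans (card_band_le x k L1 HL).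
    rewrite ler_nat; apply/subset_leq_card/fintype.subsetP => j.
    rewrite !inE => /eqP jk.
    rewrite ler_pdivlMr// mulrC ltW// -/(t j) -jk.
    by have /andP[_] := truncn_itv (t0 j).
  have L0 : 0 <= 51 * L by lra.
  have := ler_wpM2l L0 (profile_le k).
  by move: (profile k) (k.+1%:R) ((_ * _)^-1) => a b c; lra.
rewrite -mulr_sumr sum_inv_triangular; apply: ler_piMr; first by lra.
by rewrite lerBlDr lerDl invr_ge0.
Qed.

(** The modulus rho of xi at the rotated point satisfies rho^2 = 1 - t^2 <= exp(- t^2), and N t^2 >=
    (m t)^2 >= k^2. As rho itself is a square root, squares are compared: rho^(2N) <= exp(- k^2) <=
    (1 + k^2 / 4)^-4. *)
Lemma beam_decay m N A x (t : R) : SO3 A -> (m ^ 2 <= N)%N ->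
  t = `|dot (val x) (A *m delta_mx 2%:R 0)| ->
  Normc.normc (xi (A^T *m val x)) ^+ N <= profile (Num.truncn (m%:R * t)).
Proof.
move=> sA mN tE; set rho := Normc.normc _.
have t0 : 0 <= t by rewrite tE.
have rho2 : rho ^+ 2 = 1 - t ^+ 2.
  rewrite normc_sqr /=.
  have : dot (A^T *m val x) (A^T *m val x) = 1.
    by rewrite dot_SO3 ?dot_sphere//; exact: SO3_tr.
  have -> : t ^+ 2 = (A^T *m val x) 2%:R 0 ^+ 2.
    by rewrite tE real_normK ?num_real// dotC dot_mulmx dot_delta.
  by rewrite dotE; lra.
have rho0 : 0 <= rho by exact: normc_ge0.
set k := Num.truncn _; have kt : k%:R <= m%:R * t by rewrite truncn_le mulr_ge0.
have k2 : k%:R ^+ 2 <= N%:R * t ^+ 2.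
  apply: (@le_trans _ _ ((m%:R * t) ^+ 2)).
    by rewrite ler_pXn2r ?nnegrE// mulr_ge0.
  by rewrite exprMn ler_wpM2r ?sqr_ge0// -natrX ler_nat.
have e0 : 0 < 1 + k%:R ^+ 2 / 4 :> R by rewrite ltr_wpDr// divr_ge0 ?sqr_ge0.
have -> : profile k = (1 + k%:R ^+ 2 / 4) ^- 2.
  rewrite (_ : 1 + k%:R ^+ 2 / 4 = (4 + k%:R ^+ 2) / 4); last by field.
  by rewrite expr_div_n invf_div /profile; congr (_ / _); ring.
rewrite -(@ler_pXn2r _ 2) ?nnegrE ?exprn_ge0 ?invr_ge0 ?exprn_ge0 ?(ltW e0)//.
rewrite exprAC rho2.
apply: (@le_trans _ _ (expR (- t ^+ 2) ^+ N)).
  apply: lerXn2r; rewrite ?nnegrE ?expR_ge0 ?expR_ge1Dx//.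
  by rewrite -rho2 sqr_ge0.
rewrite -expRM_natl exprVn -exprM.
apply: (@le_trans _ _ (expR (- k%:R ^+ 2))); first by rewrite ler_expR; lra.
rewrite (_ : - k%:R ^+ 2 = - ((2 * 2)%:R * (k%:R ^+ 2 / 4))); last by field.
rewrite expRN expRM_natl lef_pV2 ?posrE ?exprn_gt0 ?expR_gt0//.
by rewrite ler_pXn2r ?nnegrE ?expR_ge0 ?(ltW e0)// expR_ge1Dx.
Qed.

End Counting.

(** * Sums of beams *)

Section BeamSum.
Variable R : realType.
Local Notation C := R[i].
Local Notation mu := (@surface R).
Import Normc.

Lemma beam_mass_gt0 N : (0 < N)%N -> 0 < beam_mass R N.
Proof.
move=> N0; apply: lt_le_trans (beam_mass_ge R N0).
by rewrite divr_gt0 ?divr_gt0// sqrtr_gt0 mulr_gt0// ltr0n.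
Qed.

(** The unit norm of the standard beam determines the positive factor c N^(1/4), which makes the
    amplitude common to all beams of degree N. *)
Lemma gaussian_beamP N p (Q : sphere R -> C) : (0 < N)%N -> gaussian_beam N p Q ->
  exists A, [/\ SO3 A, A *m delta_mx 2%:R 0 = val p &
    forall x, Q x = ((Num.sqrt (beam_mass R N))^-1)%:C%C * xi (A^T *m val x) ^+ N].
Proof.
move=> N0 [c [A [c0 Q1 sA Ap QE]]]; exists A; split => // x.
pose a := c * N%:R `^ 4^-1.
have a0 : 0 < a by rewrite mulr_gt0// powR_gt0// ltr0n.
have M0 := beam_mass_gt0 N0.
rewrite QE SO3_invmx// /beam0 -/a -/(xi _); congr (_%:C%C * _).
have cb : cbounded_measurable (fun x : sphere R => beam0 c N (val x)).
  apply: cbounded_measurableM; first exact: cbounded_measurable_cst.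
  apply: cbounded_measurableX; rewrite (_ : (fun x => _) = fun x => xi (1 *m val x)).
    exact: cbounded_measurable_xi.
  by apply/funext => y; rewrite mul1mx.
have := Q1; rewrite (Lnorm2E cb) => -[].
rewrite (_ : \int[mu]_x _ = a ^+ 2 * beam_mass R N); last first.
  rewrite /beam_mass -RintegralZl//; last first.
    exact/bounded_measurable_integrable/bounded_measurable_xi_exp.
  apply: eq_Rintegral => y _.
  by rewrite /beam0 -/a normcM normcX normc_real gtr0_norm// exprMn -exprM mulnC.
rewrite sqrtrM ?sqr_ge0// sqrtr_sqr gtr0_norm// => aM.
by apply: (mulIf (_ : Num.sqrt (beam_mass R N) != 0));
  rewrite ?aM ?mulVf// gt_eqF// sqrtr_gt0.
Qed.

Lemma xi_coef1 : xi_coef (1%:M : 'M[R]_3) = 1.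
Proof.
rewrite /xi_coef !mxE /=; apply/eqP; rewrite eq_complex /=.
by apply/andP; split; apply/eqP; field.
Qed.

Lemma normc_sum_le (I : Type) (s : seq I) (f : I -> C) :
  normc (\sum_(i <- s) f i) <= \sum_(i <- s) normc (f i).
Proof.
elim: s => [|i s IH]; first by rewrite !big_nil normc0.
by rewrite !big_cons; apply: le_trans (le_normcD _ _) _; rewrite lerD2l.
Qed.

(** The estimate for a single N. Separation appears only as smallness of the overlaps, so its
    constant cannot reach the final bound. *)
Lemma beam_sum_bound N m (P : 'I_m -> sphere R) (Q : 'I_m -> sphere R -> C)
    (L delta : R) : (0 < m)%N -> (m ^ 2 <= N)%N -> 0 < delta ->
  delta * Num.sqrt N%:R <= m%:R -> 1 <= L ->
  (forall G : set (sphere R), great_circle G ->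
    #|[pred j | P j \in neighborhood (m%:R^-1) G]|%:R <= L) ->
  (forall j, gaussian_beam N (P j) (Q j)) ->
  (forall j k, j != k ->
     m%:R * ((1 + dot (val (P j)) (val (P k))) / 2) ^+ N <= 1 / 2) ->
  (exists x, beam_sum Q x != 0) /\
  (sphere_Lnorm +oo (L2_normalize (beam_sum Q))
     <= (1632 * 12 * delta `^ (- 2^-1) * L)%:E)%E.
Proof.
move=> m0 mN d0 dm L1 HL gQ sep.
have N0 : (0 < N)%N by apply: leq_trans mN; rewrite expn_gt0 m0.
have [A HA] := choice (fun j => gaussian_beamP N0 (gQ j)).
have sA j : SO3 (A j) by case: (HA j).
have Ap j : A j *m delta_mx 2%:R 0 = val (P j) by case: (HA j).
have M0 := beam_mass_gt0 N0.
set a := (Num.sqrt (beam_mass R N))^-1 in HA.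
have a0 : 0 < a by rewrite invr_gt0 sqrtr_gt0.
have a2 : a ^+ 2 * beam_mass R N = 1.
  by rewrite exprVn sqr_sqrtr ?mulVf ?gt_eqF// ltW.
have FE : beam_sum Q = fun x => \sum_(j < m) a%:C%C * xi ((A j)^T *m val x) ^+ N.
  by apply/funext => x; apply: eq_bigr => j _; have [_ _ ->] := HA j.
set F := beam_sum Q in FE *.
have cF : cbounded_measurable F.
  rewrite FE; apply: cbounded_measurable_sum => j.
  apply: cbounded_measurableM; first exact: cbounded_measurable_cst.
  exact/cbounded_measurableX/cbounded_measurable_xi.
pose S := \int[mu]_x normc (F x) ^+ 2.
have m0' : 0 < m%:R :> R by rewrite ltr0n.
have Sm : m%:R / 2 <= S.
  rewrite /S FE integral_normc2_beams// a2 mul1r.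
  apply: (@le_trans _ _ (\sum_(j < m) (1 / 2 : R))).
    by rewrite sumr_const card_ord mulr_natl mul1r.
  (* Diagonal dominance: each row of the Gram matrix has diagonal entry 1 and fewer than m other
     entries, each of modulus at most 1 / (2 m). *)
  apply: ler_sum => j _; rewrite (bigD1 j)//= SO3_tr_mul// xi_coef1 expr1n /=.
  have : `|\sum_(k < m | k != j) complex.Re (xi_coef ((A k)^T *m A j) ^+ N)| <= 1 / 2.
    apply: le_trans (ler_norm_sum _ _ _) _.
    apply: (@le_trans _ _ (\sum_(k < m | k != j) (1 / 2 / m%:R))).
      apply: ler_sum => k kj; apply: le_trans (Re_le_normc _) _.
      have sB : SO3 ((A k)^T *m A j) by apply: SO3_mul => //; exact: SO3_tr.
      have B22 : ((A k)^T *m A j) 2%:R 2%:R = dot (val (P k)) (val (P j)).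
        by rewrite -!Ap dot_mulmx dot_delta mulmxA -colE [RHS]mxE.
      by rewrite normcX normc_xi_coef// B22 ler_pdivlMr// [leLHS]mulrC sep.
    rewrite sumr_const -[leLHS]mulr_natl mulrA ler_pdivrMr//.
    have : #|[pred k | k != j]|%:R <= m%:R :> R.
      by rewrite ler_nat -[leqRHS]card_ord max_card.
    by lra.
  by rewrite ler_norml => /andP[+ _]; lra.
have S0 : 0 < S by lra.
have NF : fine (sphere_Lnorm 2%:E F) = Num.sqrt S by rewrite Lnorm2E.
split.
  apply: contrapT => /forallNP F0; suff S00 : S = 0 by rewrite S00 ltxx in S0.
  rewrite /S; under eq_Rintegral => x _.
    have /negP := F0 x; rewrite negbK => /eqP ->; rewrite normc0 expr0n /=; over.
  by rewrite /Rintegral integral0.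
have q0 : 0 < delta `^ (- 2^-1) by exact: powR_gt0.
have Fle x : normc (F x) <= a * (1632 * L).
  rewrite FE; apply: le_trans (normc_sum_le _ _) _.
  under eq_bigr do rewrite normcM normc_real gtr0_norm// normcX.
  rewrite -mulr_sumr ler_pM2l//; apply: le_trans (sum_profile_le x m0 L1 HL).
  by apply: ler_sum => j _; apply: beam_decay => //; rewrite Ap.
have sS : 0 < Num.sqrt S by rewrite sqrtr_gt0.
(* With r = sqrt N, [beam_mass_ge] and sqrt 2 <= 3 / 2 give a^2 <= 64 r, while S >= m / 2 >= delta r
   / 2. The constant 12 serves because 144 / 2 >= 64. *)
have key : a <= 12 * delta `^ (- 2^-1) * Num.sqrt S.
  rewrite powRN powR12_sqrt ?(ltW d0)//; set d := Num.sqrt delta.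
  have d2 : d ^+ 2 = delta by rewrite sqr_sqrtr// ltW.
  have d0' : 0 < d by rewrite sqrtr_gt0.
  rewrite mulrAC ler_pdivlMr// -(@ler_pXn2r _ 2) ?nnegrE ?mulr_ge0 ?ltW//.
  rewrite !exprMn d2 (sqr_sqrtr (ltW S0)).
  move: dm; set r := Num.sqrt N%:R => dm.
  have r2 : r ^+ 2 = N%:R by rewrite sqr_sqrtr.
  have r0 : 0 < r by rewrite sqrtr_gt0 ltr0n.
  have := beam_mass_ge R N0; set w := Num.sqrt (2 * N%:R).
  have w2 : w ^+ 2 = 2 * r ^+ 2 by rewrite r2 sqr_sqrtr// mulr_ge0.
  have w0 : 0 < w by rewrite sqrtr_gt0 mulr_gt0// ltr0n.
  have wr : w <= 3 / 2 * r.
    have r'0 : 0 <= 3 / 2 * r by lra.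
    by rewrite -(@ler_pXn2r _ 2) ?nnegrE ?(ltW w0)// exprMn w2; have := sqr_ge0 r; lra.
  rewrite ler_pdivrMr// => Mw.
  have a20 : 0 <= a ^+ 2 by exact: sqr_ge0.
  have a2w : a ^+ 2 * (3 / 128) <= w.
    by have := ler_wpM2l a20 Mw; rewrite [X in _ <= X]mulrA a2 mul1r.
  have a2r : a ^+ 2 <= 64 * r by lra.
  by have := ler_wpM2r (ltW d0) a2r; lra.
apply: Lnormy_le => [|x].
  by apply: mulr_ge0; [apply: mulr_ge0; [lra|exact: ltW]|lra].
rewrite /L2_normalize NF -fmorphV normcM normc_real ger0_norm ?invr_ge0 ?(ltW sS)//.
rewrite ler_pdivrMr//; apply: le_trans (Fle x) _.
have L0 : 0 <= 1632 * L by lra.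
have := ler_wpM2r L0 key; lra.
Qed.

(* m exp(- eta m) <= m / (1 + eta m / 2)^2 <= 4 / (eta^2 m) *)
Lemma offdiag_small m N (eta d : R) : (0 < m)%N -> (m ^ 2 <= N)%N ->
  0 < eta -> 8 / eta ^+ 2 <= m%:R -> -1 <= d <= 1 - 2 * eta / m%:R ->
  m%:R * ((1 + d) / 2) ^+ N <= 1 / 2.
Proof.
move=> m0 mN eta0 etam /andP[d1 d2].
have m0' : 0 < m%:R :> R by rewrite ltr0n.
have em0 : 0 < eta * m%:R by rewrite mulr_gt0.
have e1 : ((1 + d) / 2) ^+ N <= expR (- (eta / m%:R)) ^+ N.
  apply: lerXn2r; rewrite ?nnegrE ?expR_ge0//; first by lra.
  by apply: le_trans (expR_ge1Dx _); lra.
have e2 : expR (- (eta / m%:R)) ^+ N <= expR (- (2 * (eta * m%:R / 2))).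
  rewrite -expRM_natl ler_expR mulrN lerN2.
  rewrite [leLHS](_ : _ = (m ^ 2)%:R * (eta / m%:R)).
    by rewrite ler_wpM2r ?ler_nat// divr_ge0// ltW.
  by rewrite natrX; field; rewrite gt_eqF.
have e3 : expR (- (2 * (eta * m%:R / 2))) <= ((eta * m%:R / 2) ^+ 2)^-1.
  rewrite expRN expRM_natl lef_pV2 ?posrE ?exprn_gt0 ?expR_gt0 ?divr_gt0//.
  rewrite ler_pXn2r ?nnegrE ?expR_ge0 ?divr_ge0 ?(ltW em0)//.
  by apply: le_trans (expR_ge1Dx _); lra.
apply: (@le_trans _ _ (m%:R * ((eta * m%:R / 2) ^+ 2)^-1)).
  by rewrite ler_wpM2l ?(ltW m0')// (le_trans e1)// (le_trans e2).
rewrite ler_pdivrMr ?exprn_gt0 ?divr_gt0//.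
move: etam; rewrite ler_pdivrMr ?exprn_gt0// => etam.
by have := ler_wpM2l (ltW m0') etam; lra.
Qed.

Lemma beam_countP (delta : R) N : 0 < delta ->
  delta * Num.sqrt N%:R <= (beam_count delta N)%:R <= delta * Num.sqrt N%:R + 1.
Proof.
move=> d0; have : 0 <= delta * Num.sqrt N%:R by rewrite mulr_ge0 ?sqrtr_ge0// ltW.
move=> /truncn_itv/andP[t1 t2]; rewrite /beam_count (ltW t2) /=.
by rewrite -natr1 lerD2r.
Qed.

(** The bound m <= sqrt N / 2 + 1 is at most sqrt N as soon as sqrt N >= 2. *)
Lemma beam_count_sqr (delta : R) N : 0 < delta -> delta <= 1 / 2 -> (4 <= N)%N ->
  (beam_count delta N ^ 2 <= N)%N.
Proof.
move=> d0 d1 N4; rewrite -(ler_nat R) natrX.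
have N4' : 4%:R <= N%:R :> R by rewrite ler_nat.
have := beam_countP N d0; set r := Num.sqrt N%:R => /andP[_ mr].
have r2 : r ^+ 2 = N%:R by rewrite sqr_sqrtr.
have r0 : 0 <= r by exact: sqrtr_ge0.
have r2' : 2 <= r by rewrite -(@ler_pXn2r _ 2) ?nnegrE// r2; lra.
rewrite -r2 ler_pXn2r ?nnegrE//; apply: le_trans mr _.
by have := ler_wpM2r r0 d1; lra.
Qed.

Lemma beam_count_large (delta K : R) : 0 < delta ->
  \forall N \near \oo, K <= (beam_count delta N)%:R.
Proof.
move=> d0; near=> N.
have /andP[+ _] := beam_countP N d0; apply: le_trans.
rewrite -ler_pdivrMl//; apply: le_trans (ler_norm _) _.
rewrite -sqrtr_sqr ler_wsqrtr//.
near: N; exact: nbhs_infty_ger.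
Unshelve. all: by end_near. Qed.

End BeamSum.

Theorem theorem1p2 (R : realType) :
  exists delta0 C : R, [/\ 0 < delta0, delta0 < 1, 0 < C &
  forall delta : R, 0 < delta -> delta <= delta0 ->
  forall (p : forall m : nat, 'I_m -> sphere R) (L : nat -> R),
  separation_condition p ->
  great_circle_condition p L ->
  forall Q : forall N : nat, 'I_(beam_count delta N) -> sphere R -> R[i],
  (forall (N : nat) (j : 'I_(beam_count delta N)), (0 < N)%N ->
     gaussian_beam N (p (beam_count delta N) j) (Q N j)) ->
  let F := fun N : nat => beam_sum (Q N) in
  let u := fun N : nat => L2_normalize (F N) in
  (\forall N \near \oo,
     (exists x, F N x != 0) /\
     (sphere_Lnorm +oo (u N)
        <= (C * delta `^ (- 2^-1) * L (beam_count delta N))%:E)%E) /\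
  ((exists K : R, \forall m \near \oo, `|L m| <= K) ->
   exists K : R, \forall N \near \oo,
     (sphere_Lnorm +oo (u N) <= K%:E)%E)].
Proof.
exists (1 / 2), (1632 * 12); split; [by lra|by lra|by lra|].
move=> delta d0 d1 p L [c c0 sep] gc Q gQ F u.
(* Capped at 1 so that c' / sqrt m stays in [0, 1], where the quadratic bound on the cosine
   holds. *)
pose c' := Num.min c 1.
have c'0 : 0 < c' by rewrite lt_min c0 ltr01.
have c'c : c' <= c by rewrite ge_min lexx.
have c'1 : c' <= 1 by rewrite ge_min lexx orbT.
(* Chosen so that the cosine of a distance at least c' / sqrt m is at most 1 - 2 eta / m, the form
   required by [offdiag_small]. *)
pose eta := cos 1 ^+ 2 / 4 * c' ^+ 2.
have eta0 : 0 < eta by rewrite mulr_gt0 ?divr_gt0 ?exprn_gt0// cos1_gt0.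
have main : \forall N \near \oo,
     (exists x, F N x != 0) /\
     (sphere_Lnorm +oo (u N)
        <= (1632 * 12 * delta `^ (- 2^-1) * L (beam_count delta N))%:E)%E.
  near=> N.
  have mK : 8 / eta ^+ 2 <= (beam_count delta N)%:R.
    by near: N; exact: beam_count_large.
  set m := beam_count delta N in mK *.
  have m0 : (0 < m)%N by [].
  have m1 : 1 <= m%:R :> R by rewrite ler1n.
  have N4 : (4 <= N)%N by near: N; exact: nbhs_infty_ge.
  have mN : (m ^ 2 <= N)%N by exact: beam_count_sqr.
  have [L1 HL] := gc m m0.
  have /andP[dm _] := beam_countP N d0.
  apply: (beam_sum_bound m0 mN d0 dm L1 HL) => [j|j k jk].
    by apply: gQ; apply: leq_trans N4.
  apply: (offdiag_small m0 mN eta0 mK).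
  have /andP[-> _] := dot_sphere_le1 (p m j) (p m k) => /=.
  have s1 : 1 <= Num.sqrt m%:R :> R by rewrite -[leLHS]sqrtr1 ler_wsqrtr.
  have s0 : 0 < Num.sqrt m%:R :> R by rewrite (lt_le_trans ltr01).
  have r01 : 0 <= c' / Num.sqrt m%:R <= 1.
    by rewrite divr_ge0 ?(ltW c'0) ?(ltW s0)//= ler_pdivrMr// mul1r (le_trans c'1).
  have := geodist_dot_le r01 (le_trans _ (sep m j k jk)).
  rewrite ler_pM2r ?invr_gt0// => /(_ c'c) /le_trans; apply.
  rewrite expr_div_n sqr_sqrtr// /eta le_eqVlt; apply/orP; left; apply/eqP.
  by field; rewrite gt_eqF// ltr0n.
split=> // -[K LK]; exists (1632 * 12 * delta `^ (- 2^-1) * K).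
(* The bound on L holds only for large m; it transfers to large N because the number of beams tends
   to infinity with N. *)
have [m0 _ Lm0] := LK; near=> N.
have [_ uN] : (exists x, F N x != 0) /\
     (sphere_Lnorm +oo (u N)
        <= (1632 * 12 * delta `^ (- 2^-1) * L (beam_count delta N))%:E)%E.
  by near: N.
apply: (le_trans uN); rewrite lee_fin; apply: ler_wpM2l.
  by apply: mulr_ge0; [lra|exact: powR_ge0].
apply: (le_trans (ler_norm _)); apply: Lm0; rewrite /= -(ler_nat R).
by near: N; exact: beam_count_large.
Unshelve. all: by end_near. Qed.
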